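(* Let $\phi:E\times E\to\mathbb{R}$ be a conserved quantity, and suppose that $(\mu_t)_{t\ge0}$ is a solution of the multi-type Flory equation with conserved quantity $\phi$ and initial condition $\mu_0$ such that $\|\mu_0\|<\infty$. For $k\in\mathbb{N}$ (and likewise for real $k>0$) let $$D_k:=\left\{x\in E:\int_E\phi(x,y)\,\mu_0(\mathrm{d}y)\le k\right\}.$$ Assume that $D_k$ is compact for each $k\in\mathbb{N}$ sufficiently large and that $\bigcup_{k\in\mathbb{N}}D_k=E$; that there is $c'>0$ with $\bar K(x,y)\le c'\phi(x,y)$ for all $x,y\in E$; and that for some $R$ sufficiently large $\phi(x,y)=\bar K(x,y)$ for all $(x,y)\in(D_R\times D_R)^c$. Then the solution $(\mu_t)_{t\ge0}$ is unique, i.e. it is the only solution of the multi-type Flory equation with conserved quantity $\phi$ and initial condition $\mu_0$.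
   Context: **Space and kernel.** $E$ is a $\sigma$-compact metric space with Borel $\sigma$-algebra $\mathcal{B}$; $\mathcal{M}_+(E)$ is the set of finite positive measures on $E$, $\|\mu\|=\mu(E)$, $\langle f,\mu\rangle=\int_Ef\,\mathrm{d}\mu$; $C_c(E)$ is the set of continuous compactly supported functions $E\to\mathbb{R}$. $m:E\to(0,\infty)$ is a (measurable) mass function. $K:E\times E\times\mathcal{B}\to[0,\infty)$ is a coagulation kernel: $(x,y)\mapsto K(x,y,A)$ is measurable for each $A\in\mathcal{B}$; $K(x,y,\cdot)$ is a measure; $K(x,y,A)=K(y,x,A)$; $\bar K(x,y):=K(x,y,E)<\infty$; and $m(z)=m(x)+m(y)$ for $K(x,y,\cdot)$-a.a. $z$. **Conserved quantity.** $\phi:E\times E\to\mathbb{R}$ is a *conserved quantity* (is *conservative* ) if for all $x,y,q\in E$, for $K(x,y,\cdot)$-a.a. $z$, $\phi(z,q)=\phi(x,q)+\phi(y,q)$. **Solutions.** A map $t\mapsto\mathbf{u}_t\in\mathcal{M}_+(E)$, $t\ge0$, is a *solution of the multi-type Flory equation with conserved quantity $\phi$* and initial condition $\mathbf{u}_0$ if: 1. for all Borel $A\subseteq E$, $t\mapsto\mathbf{u}_t(A)$ is measurable; 2. for all $f\in C_c(E)$ and $t\ge0$: $\langle f,\mathbf{u}_0\rangle<\infty$, $\int_0^t\int_{E\times E}f(y)\bar K(x,y)\mathbf{u}_s(\mathrm{d}x)\mathbf{u}_s(\mathrm{d}y)\mathrm{d}s<\infty$ and $\int_0^t\int_{E\times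 E}f(y)\phi(x,y)\mathbf{u}_0(\mathrm{d}x)\mathbf{u}_s(\mathrm{d}y)\mathrm{d}s<\infty$; 3. for all $f\in C_c(E)$ and $t\ge0$: $\langle f,\mathbf{u}_t\rangle=\langle f,\mathbf{u}_0\rangle+\int_0^t\langle f,Q^+(\mathbf{u}_s)-Q^-(\mathbf{u}_s)\rangle\,\mathrm{d}s$, where $$\langle f,Q^+(\mathbf{u}_s)\rangle=\frac12\int_{E\times E\times E}f(z)K(x,y,\mathrm{d}z)\mathbf{u}_s(\mathrm{d}x)\mathbf{u}_s(\mathrm{d}y),$$ $$\langle f,Q^-(\mathbf{u}_s)\rangle=\int_{E\times E}f(y)\bar K(x,y)\mathbf{u}_s(\mathrm{d}x)\mathbf{u}_s(\mathrm{d}y)+\int_E f(y)\left(\int_E\phi(x,y)\mathbf{u}_0(\mathrm{d}x)-\int_E\phi(x,y)\mathbf{u}_s(\mathrm{d}x)\right)\mathbf{u}_s(\mathrm{d}y);$$ 4. for each $x\in E$ and $t\ge0$: $\int_E\phi(u,x)\,\mathbf{u}_t(\mathrm{d}u)\le\int_E\phi(u,x)\,\mathbf{u}_0(\mathrm{d}u)$. **Remark on symmetry.** The paper remarks that the hypothesis $\phi=\bar K$ on $(D_R\times D_R)^c$, combined with the symmetry of $\bar K$, implies that $\phi$ is symmetric.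
   Formalization: The formal theorem also assumes that E is locally compact (on E = ℚ, C_c(E) = {0} and uniqueness fails) and that φ is symmetric, as the paper asserts, although its hypotheses give this only outside D_R × D_R; φ is taken measurable. *)

(* Defs.v *)
From HB Require Import structures.
From mathcomp Require Import all_boot all_order all_algebra.
From mathcomp Require Import all_classical all_reals all_analysis.
From mathcomp Require Import measurable_realfun.

Set Implicit Arguments.
Unset Strict Implicit.
Unset Printing Implicit Defensive.

Import Order.TTheory GRing.Theory Num.Theory.
Import numFieldNormedType.Exports.

Local Open Scope classical_set_scope.
Local Open Scope ring_scope.

(* The two structures are unrelated here: that the sigma-algebra is the Borel
   one is the separate hypothesis [borel_sigma_algebra]. *)
#[short(type="metricMeasurableType")]
HB.structure Definition MetricMeasurable (R : realType) (d : measure_display) :=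
  { E of Metric R E & Measurable d E }.

Definition borel_sigma_algebra (R : realType) (d : measure_display)
    (E : metricMeasurableType R d) : Prop :=
  @measurable d E = <<s [set U : set E | open U] >>.

Definition sigma_compact (T : topologicalType) : Prop :=
  exists2 F : (set T)^nat, (forall n, compact (F n)) & \bigcup_n F n = setT.

Section flory.
Context {R : realType} {d : measure_display} {E : metricMeasurableType R d}.

Definition compactly_supported_continuous (f : E -> R) : Prop :=
  continuous f /\ compact (closure [set x | f x != 0]).

Section coagulation.
Variables (m : E -> R) (K : R.-ker (E * E) ~> E).

Definition total_rate (x y : E) : \bar R := K (x, y) setT.

Record coagulation_kernel : Prop := {
  coag_sym : forall x y (A : set E), measurable A -> K (x, y) A = K (y, x) A ;
  coag_finite : forall x y, (total_rate x y < +oo)%E ;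
  coag_mass : forall x y, {ae K (x, y), forall z, m z = m x + m y} }.

Definition conserved_quantity (phi : E * E -> R) : Prop :=
  forall x y q, {ae K (x, y), forall z, phi (z, q) = phi (x, q) + phi (y, q)}.

Local Open Scope ereal_scope.

Definition flory_gain (u : {finite_measure set E -> \bar R}) (f : E -> R) :
    \bar R :=
  (2^-1)%R%:E * \int[u \x u]_p \int[K p]_z (f z)%:E.

Definition flory_loss (phi : E * E -> R)
    (u0 u : {finite_measure set E -> \bar R}) (f : E -> R) : \bar R :=
  \int[u \x u]_p ((f p.2)%:E * total_rate p.1 p.2) +
  \int[u]_y ((f y)%:E *
    (\int[u0]_x (phi (x, y))%:E - \int[u]_x (phi (x, y))%:E)).

(* In the three finiteness conditions the integrand carries an absolute value,
   so that they express that the integrals exist and are finite; as |f| is a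
   test function whenever f is, for phi >= 0 this is the same as asking all the
   integrals without absolute value to be < +oo. *)
Record flory_solution (phi : E * E -> R)
    (u0 : {finite_measure set E -> \bar R})
    (u : R -> {finite_measure set E -> \bar R}) : Prop := {
  flory_init : forall A : set E, measurable A -> u 0%R A = u0 A ;
  flory_measurable : forall A : set E, measurable A ->
    measurable_fun (`[0%R, +oo[ : set R) (fun t => u t A) ;
  flory_fin_init : forall f, compactly_supported_continuous f ->
    \int[u0]_x `|(f x)%:E| < +oo ;
  flory_fin_coag : forall f, compactly_supported_continuous f ->
    forall t, (0 <= t)%R ->
    \int[lebesgue_measure]_(s in `[0%R, t])
      \int[u s \x u s]_p `|(f p.2)%:E * total_rate p.1 p.2| < +oo ;
  flory_fin_phi : forall f, compactly_supported_continuous f ->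
    forall t, (0 <= t)%R ->
    \int[lebesgue_measure]_(s in `[0%R, t])
      \int[u0 \x u s]_p `|(f p.2 * phi p)%:E| < +oo ;
  flory_eq : forall f, compactly_supported_continuous f ->
    forall t, (0 <= t)%R ->
    \int[u t]_x (f x)%:E = \int[u0]_x (f x)%:E +
      \int[lebesgue_measure]_(s in `[0%R, t])
        (flory_gain (u s) f - flory_loss phi u0 (u s) f) ;
  flory_conserved_le : forall x t, (0 <= t)%R ->
    \int[u t]_w (phi (w, x))%:E <= \int[u0]_w (phi (w, x))%:E }.

End coagulation.

Definition flory_domain (phi : E * E -> R)
    (u0 : {finite_measure set E -> \bar R}) (k : R) : set E :=
  [set x | (\int[u0]_y (phi (x, y))%:E <= k%:E)%E].

End flory.

(* Main.v *)
Require Import Defs.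
From HB Require Import structures.
From mathcomp Require Import all_boot all_order all_algebra.
From mathcomp Require Import all_classical all_reals all_analysis.
From mathcomp Require Import measurable_realfun.
From mathcomp Require Import ring.

(** Two solutions are compared on a domain [D = flory_domain phi mu0 k], the set
    of types with potential [Phi x = \int phi (x, y) mu0 (dy)] at most [k].

    A domain evolves autonomously. Conservation gives [Phi z = Phi x + Phi y]
    for almost every result [z] of a coagulation of [x] and [y], and [phi] is
    nonnegative because it dominates the total rate; hence a particle in [D] has
    both parents in [D] ([coagulation_outside_domain]). In the loss, types
    outside [D] enter only through the difference of the total rate and [phi],
    which vanishes there once [D] is large.

    On a domain the equation is Lipschitz for the total variation distance.
    The kernel may be unbounded, but it is dominated by [phi], and each solution
    satisfies [\int phi (x, y) u_t (dx) <= Phi y <= k] for [y] in [D]. Writing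
    [m m - n n = (m - n) m + n (m - n)], one only meets such integrals of [phi]
    ([le_integral_product_of_le_measure], [flow_compare]). The distance is
    encoded by inequalities [m B <= n B + b] over the measurable subsets [B] of
    [D].

    This requires the equation for indicators instead of continuous test
    functions. All terms are moved to the side where they are nonnegative
    ([balance_test_function]), so that both sides become Borel measures, which
    agree on test functions and hence on all Borel sets
    ([represented_eq_indic], [balance_set]); compactness of [D] makes the
    measure of [D] finite.

    Starting from a constant bound on [[0, t]], the Lipschitz estimate improves
    the discrepancy on [D] to [b * (C * t) ^+ n / n`!] for every [n]
    ([gronwall_bound]), so the solutions coincide on [D]; the domains cover the
    space. *)

Set Implicit Arguments.
Unset Strict Implicit.
Unset Printing Implicit Defensive.

Import Order.TTheory GRing.Theory Num.Theory.
Import numFieldNormedType.Exports.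

Local Open Scope classical_set_scope.
Local Open Scope ring_scope.

(** * Integration against families of measures *)

Section indicator.
Local Open Scope ereal_scope.
Context d (T : measurableType d) (R : realType).

Lemma integral_indicT (m : {measure set T -> \bar R}) (A : set T) :
  measurable A -> \int[m]_x (\1_A x)%:E = m A.
Proof. by move=> mA; rewrite integral_indic// setIT. Qed.

Lemma measurable_EFin_indic (A : set T) : measurable A ->
  measurable_fun setT (fun x => (\1_A x)%:E : \bar R).
Proof. by move=> mA; exact/measurable_EFinP/measurable_indic. Qed.

End indicator.

Section mixture.
Local Open Scope ereal_scope.
Context d d' (X : measurableType d) (Y : measurableType d') (R : realType).
Variables (la : {measure set X -> \bar R}) (D : set X) (mD : measurable D).
Variable k : X -> {measure set Y -> \bar R}.
Hypothesis mk : forall U, measurable U -> measurable_fun D (k ^~ U).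

(** The two proofs are arguments, so that the instance below sees the
    hypotheses that make this set function a measure. *)
Definition mixture of measurable D
    & (forall U, measurable U -> measurable_fun D (k ^~ U)) :=
  fun U : set Y => \int[la]_(x in D) k x U.

Local Notation mix := (mixture mD mk).

Let mixture0 : mix set0 = 0.
Proof. by rewrite /mixture integral0_eq. Qed.

Let mixture_ge0 U : 0 <= mix U.
Proof. exact: integral_ge0. Qed.

Let mixture_sigma_additive : semi_sigma_additive mix.
Proof.
move=> U mU tU mUU; rewrite [X in _ --> X](_ : _ =
  \int[la]_(x in D) (\sum_(n <oo) k x (U n))); last first.
  apply: eq_integral => x _.
  by apply/esym/cvg_lim => //; exact/measure_semi_sigma_additive.
apply/cvg_closeP; split.
  by apply: is_cvg_nneseries => n _ _; exact: integral_ge0.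
by rewrite closeE// integral_nneseries// => n; exact: mk.
Qed.

HB.instance Definition _ := isMeasure.Build _ _ _ mix
  mixture0 mixture_ge0 mixture_sigma_additive.

Import HBNNSimple.

Let nnsfun_kernelE x (h : {nnsfun Y >-> R}) :
  \int[k x]_y (h y)%:E = \sum_(r \in range h) r%:E * k x (h @^-1` [set r]).
Proof.
by rewrite integralT_nnsfun sintegralE.
Qed.

Let measurable_nnsfun_kernel (h : {nnsfun Y >-> R}) :
  measurable_fun D (fun x => \int[k x]_y (h y)%:E).
Proof.
under eq_fun do rewrite nnsfun_kernelE.
apply: emeasurable_fsum => // r.
exact/measurable_funeM/mk.
Qed.

Let integral_mixture_nnsfun (h : {nnsfun Y >-> R}) :
  \int[mix]_y (h y)%:E = \int[la]_(x in D) \int[k x]_y (h y)%:E.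
Proof.
under [RHS]eq_integral do rewrite nnsfun_kernelE.
rewrite integralT_nnsfun sintegralE ge0_integral_fsum//; last 2 first.
- by move=> r; exact/measurable_funeM/mk.
- by move=> r x _; exact: nnsfun_mulemu_ge0.
apply: eq_fsbigr => r /[!inE] -[y _ <-].
by rewrite ge0_integralZl_EFin// ?fun_ge0//; exact: mk.
Qed.

Lemma integral_mixture (f : Y -> \bar R) : (forall y, 0 <= f y) ->
  measurable_fun setT f ->
  \int[mix]_y f y = \int[la]_(x in D) \int[k x]_y f y.
Proof.
move=> f0 mf; pose h := nnsfun_approx measurableT mf.
have hE (m : {measure set Y -> \bar R}) :
    \int[m]_y f y = limn (fun n => \int[m]_y (h n y)%:E).
  rewrite -monotone_convergence//; first 1 last.
  - by move=> n; exact/measurable_EFinP.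
  - by move=> n y _; rewrite lee_fin.
  - by move=> y _ a b ab; rewrite lee_fin; exact/lefP/nd_nnsfun_approx.
  by apply: eq_integral => y _; apply/esym/cvg_lim => //; exact: cvg_nnsfun_approx.
rewrite hE; under eq_integral do rewrite hE.
rewrite monotone_convergence//.
- by congr (limn _); apply/funext => n; rewrite integral_mixture_nnsfun.
- by move=> n x _; apply: integral_ge0 => y _; rewrite lee_fin.
- move=> x _ a b ab; apply: ge0_le_integral => //.
  + by move=> y _; rewrite lee_fin.
  + exact/measurable_EFinP.
  + exact/measurable_EFinP.
  + by move=> y _; rewrite lee_fin; exact/lefP/nd_nnsfun_approx.
Qed.

End mixture.

Section finite_transition.
Local Open Scope ereal_scope.
Context d d' (X : measurableType d) (Y : measurableType d') (R : realType).

Import HBNNSimple.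

(** No bound uniform in [x] is asked of the total masses, which suits a family
    of measures indexed by an unbounded time. *)
Lemma measurable_fun_integral_transition (k : X -> {measure set Y -> \bar R})
    (f : X * Y -> \bar R) :
  (forall U, measurable U -> measurable_fun setT (k ^~ U)) ->
  (forall x, k x setT < +oo) ->
  (forall z, 0 <= f z) -> measurable_fun setT f ->
  measurable_fun setT (fun x => \int[k x]_y f (x, y)).
Proof.
move=> mk kfin f0 mf.
pose k' : R.-ker X ~> Y := HB.pack k (isKernel.Build _ _ X Y R k mk).
pose h := nnsfun_approx measurableT mf.
apply: (measurable_fun_xsection_integral _ _ h) => //.
- by move=> a b ab; exact/nd_nnsfun_approx.
- by move=> z; exact/cvg_nnsfun_approx.
move=> n r.
have kE : (fun x => k x (xsection (h n @^-1` [set r]) x)) =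
    (fun x => mrestr (k x) measurableT (xsection (h n @^-1` [set r]) x)).
  by apply/funext => x; rewrite /mrestr/= setIT.
rewrite kE.
suff kfin' x : exists M, forall B, measurable B ->
    mrestr (k' x) measurableT B < M%:E.
  have mh : measurable (h n @^-1` [set r]) by [].
  by have [] := measurable_prod_subset_xsection_kernel (k := k') kfin' mh.
exists (fine (k x setT) + 1)%R => B mB.
rewrite /mrestr/= setIT (@le_lt_trans _ _ (k x setT))//.
  by rewrite le_measure// inE.
by rewrite EFinD fineK ?ge0_fin_numE// lteDl// ge0_fin_numE.
Qed.

End finite_transition.

Section represented.
Local Open Scope ereal_scope.
Context d (Y : measurableType d) (R : realType).
Implicit Types (I J : (Y -> \bar R) -> \bar R) (F : Y -> \bar R).

(** The functionals that are integration against some measure. Both sides of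
    the Flory equation are iterated integrals of the test function; this
    predicate, stable under the operations that build them, turns them into
    measures without ever naming these measures. *)
Definition represented I := exists m : {measure set Y -> \bar R},
  forall F, (forall y, 0 <= F y) -> measurable_fun setT F ->
    I F = \int[m]_y F y.

Lemma represented_integral (m : {measure set Y -> \bar R}) :
  represented (fun F => \int[m]_y F y).
Proof. by exists m. Qed.

Lemma represented_eval (c : \bar R) (y : Y) : 0 <= c -> c \is a fin_num ->
  represented (fun F => F y * c).
Proof.
move=> c0 cfin; pose c' := NngNum (fine_ge0 c0).
exists (mscale c' (\d_y)) => F F0 mF.
rewrite ge0_integral_mscale//= integral_dirac// diracT mul1e fineK//.
by rewrite muleC.
Qed.

Lemma represented_add I J : represented I -> represented J ->
  represented (fun F => I F + J F).
Proof.
move=> [m mE] [n nE]; exists (measure_add m n) => F F0 mF.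
by rewrite ge0_integral_measure_add// mE// nE.
Qed.

Lemma represented_scale (c : {nonneg R}) I : represented I ->
  represented (fun F => c%:num%:E * I F).
Proof.
move=> [m mE]; exists (mscale c m) => F F0 mF.
by rewrite ge0_integral_mscale// mE.
Qed.

Lemma represented_mixture d' (X : measurableType d')
    (la : {measure set X -> \bar R}) (D : set X)
    (I : X -> (Y -> \bar R) -> \bar R) : measurable D ->
  (forall x, represented (I x)) ->
  (forall A, measurable A ->
    measurable_fun D (fun x => I x (fun y => (\1_A y)%:E))) ->
  represented (fun F => \int[la]_(x in D) I x F).
Proof.
move=> mD /choice[k kE] mI.
have mk A : measurable A -> measurable_fun D (k ^~ A).
  move=> mA; apply: eq_measurable_fun (mI A mA) => x _.
  rewrite kE//; first by rewrite integral_indicT.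
  exact: measurable_EFin_indic.
exists (mixture la mD mk) => F F0 mF.
by rewrite integral_mixture//; apply: eq_integral => x _; exact: kE.
Qed.

Lemma represented_le_indic I (A B : set Y) : represented I ->
  measurable A -> measurable B -> A `<=` B ->
  I (fun y => (\1_A y)%:E) <= I (fun y => (\1_B y)%:E).
Proof.
move=> [m mE] mA mB AB.
rewrite !mE//; [|exact: measurable_EFin_indic..].
by rewrite !integral_indicT// le_measure// inE.
Qed.

End represented.

(** * Comparison of integrals *)

Section integral_difference.
Local Open Scope ereal_scope.
Context d (T : measurableType d) (R : realType).
Variables (m : {measure set T -> \bar R}) (D : set T).
Hypothesis mD : measurable D.

Let funeneg_sub_le (x y : \bar R) : 0 <= x -> 0 <= y ->
  Order.max (- (x - y)) 0 <= y.
Proof.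
move=> x0 y0; rewrite ge_max y0 andbT.
move: x y x0 y0 => [x||] [y||]//= x0 y0; rewrite ?leey ?leNye//.
by rewrite lee_fin opprB lerBlDr lerDl -lee_fin.
Qed.

Let funepos_sub_ge (x y : \bar R) : 0 <= x -> 0 <= y ->
  x <= Order.max (x - y) 0 + y.
Proof.
move: x y => [x||] [y||]//= x0 y0.
- by rewrite -EFinB -EFin_max -EFinD lee_fin -lerBlDr le_max lexx.
- by rewrite addey ?leey// -ltNye lt_max ltNy0 orbT.
- by rewrite addey ?leey// -ltNye lt_max ltNy0 orbT.
Qed.

(** [X] is not assumed integrable. Since [Y] is, the negative part of [X - Y]
    has a finite integral; a finite integral of [Z] then bounds the positive
    part too, and the integrability of [X] follows. *)
Lemma integral_ae_difference (X Y Z : T -> \bar R) :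
  measurable_fun D X -> measurable_fun D Y -> measurable_fun D Z ->
  (forall x, D x -> 0 <= X x) -> (forall x, D x -> 0 <= Y x) ->
  ae_eq m D Z (X \- Y) -> \int[m]_(x in D) Y x < +oo ->
  \int[m]_(x in D) Z x \is a fin_num ->
  \int[m]_(x in D) X x = \int[m]_(x in D) Z x + \int[m]_(x in D) Y x.
Proof.
move=> mX mY mZ X0 Y0 ZXY Yfin.
have mXY : measurable_fun D (X \- Y) by exact: emeasurable_funB.
have mXYp : measurable_fun D (X \- Y)^\+ by exact: measurable_funepos.
have mXYn : measurable_fun D (X \- Y)^\- by exact: measurable_funeneg.
rewrite (ae_eq_integral (X \- Y) Z mD mZ mXY ZXY) => XYfin.
have nfin : \int[m]_(x in D) (X \- Y)^\- x \is a fin_num.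
  rewrite ge0_fin_numE; last exact: integral_ge0.
  apply: le_lt_trans Yfin; apply: ge0_le_integral => // x Dx.
  by rewrite funenegE; apply: funeneg_sub_le; [exact: X0|exact: Y0].
have pfin : \int[m]_(x in D) (X \- Y)^\+ x < +oo.
  move: XYfin; rewrite integralE fin_numE => /andP[_].
  have : 0 <= \int[m]_(x in D) (X \- Y)^\+ x by exact: integral_ge0.
  by case: (integral _ _ (X \- Y)^\+) => [r _ _||]; rewrite ?ltry// -(fineK nfin).
have Xfin : \int[m]_(x in D) X x < +oo.
  apply: (@le_lt_trans _ _ (\int[m]_(x in D) ((X \- Y)^\+ x + Y x))).
    apply: ge0_le_integral => //.
      exact: emeasurable_funD.
    by move=> x Dx; rewrite funeposE; apply: funepos_sub_ge; [exact: X0|exact: Y0].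
  by rewrite ge0_integralD// lte_add_pinfty.
have iX : m.-integrable D X.
  apply/integrableP; split => //; rewrite (eq_integral X)// => x /[!inE] Dx.
  by rewrite gee0_abs// X0.
have iY : m.-integrable D Y.
  apply/integrableP; split => //; rewrite (eq_integral Y)// => x /[!inE] Dx.
  by rewrite gee0_abs// Y0.
rewrite integralB// subeK// ge0_fin_numE//; exact: integral_ge0.
Qed.

End integral_difference.

Section measure_comparison.
Local Open Scope ereal_scope.
Context d (T : measurableType d) (R : realType).

(** Tonelli for the region under the graph of [g]. *)
Lemma layer_cake (m : {finite_measure set T -> \bar R}) (g : T -> \bar R)
    (M : R) : measurable_fun setT g ->
  (forall x, 0 <= g x) -> (forall x, g x <= M%:E) ->
  \int[m]_x g x =
  \int[lebesgue_measure]_(r in `[0%R, M]) m [set x | r%:E < g x].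
Proof.
move=> mg g0 gM; pose leb := @lebesgue_measure R.
have lebE (a : R) : (0 <= a)%R -> lebesgue_measure (`[0%R, a[%classic : set R) = a%:E.
  rewrite lebesgue_measure_itv/= lte_fin sube0 le_eqVlt.
  by move=> /predU1P[<-|->//]; rewrite ltxx.
pose A := [set p : T * measurableTypeR R | (0 <= p.2)%R /\ p.2%:E < g p.1].
have mA : measurable A.
  have -> : A = [set p | 0 <= (EFin \o snd) p] `&`
      [set p : T * measurableTypeR R | (EFin \o snd) p < (g \o fst) p].
    by apply/seteqP; split => p; rewrite /A /= lee_fin.
  have ms : measurable_fun setT (EFin \o (snd : T * measurableTypeR R -> _)).
    exact/measurable_EFinP.
  apply: measurableI.
    by rewrite -[X in measurable X]setTI; exact: measurable_lee.
  by rewrite -[X in measurable X]setTI; apply: measurable_lte => //;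
    exact: measurableT_comp.
transitivity (\int[m]_x \int[leb]_r (\1_A (x, r))%:E).
  apply: eq_integral => x _.
  have gfin : g x \is a fin_num.
    by rewrite ge0_fin_numE// (le_lt_trans (gM x))// ltry.
  rewrite (_ : (fun r => _) = EFin \o \1_(`[0%R, fine (g x)[%classic : set R)).
    by rewrite integral_indic// setIT -[LHS]fineK//; apply/esym/lebE/fine_ge0.
  apply/funext => r /=; rewrite !indicE; congr (_%:R%:E); congr nat_of_bool.
  apply/idP/idP; rewrite !inE /A /= in_itv/= -lte_fin fineK//.
    by move=> [-> ->].
  by move=> /andP[-> ->].
rewrite (fubini_tonelli (fun p : T * measurableTypeR R => (\1_A p)%:E))//; last first.
  exact/measurable_EFinP/measurable_indic.
rewrite [RHS]integral_mkcond; apply: eq_integral => r _.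
rewrite patchE; case: ifPn => [/[!inE]|rM].
  rewrite /= in_itv/= => /andP[r0 _].
  have mr : measurable [set x | r%:E < g x].
    by rewrite -[X in measurable X]setTI; exact: emeasurable_fun_o_infty.
  rewrite -[in RHS](setIT [set x | r%:E < g x]) -integral_indic//.
  apply: eq_integral => x _; rewrite !indicE; congr (_%:R%:E); congr nat_of_bool.
  by apply/idP/idP; rewrite !inE /A /= => // -[].
apply: integral0_eq => x _; rewrite indicE memNset// /A /= => -[r0 rg].
move: rM; rewrite mem_set//= in_itv/= r0/= -lee_fin.
by rewrite (le_trans (ltW rg)).
Qed.

(** If [m] exceeds [n] by at most [b] on the subsets of [D], the same holds for
    integrals of functions between 0 and 1 vanishing off [D]: apply the
    hypothesis to each superlevel set and integrate over the level. The
    one-sided bound on sets thus replaces a total variation norm, and no signed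
    measure is needed. *)
Lemma le_integral_of_le_measure (m n : {finite_measure set T -> \bar R})
    (D : set T) (b : R) :
  (forall B, measurable B -> B `<=` D -> m B <= n B + b%:E) ->
  (0 <= b)%R ->
  forall (g : T -> \bar R) (M : R), measurable_fun setT g ->
  (forall x, 0 <= g x) -> (forall x, g x <= M%:E) ->
  (forall x, ~ D x -> g x = 0) -> (0 <= M)%R ->
  \int[m]_x g x <= \int[n]_x g x + (M * b)%:E.
Proof.
move=> mn b0 g M mg g0 gM gD M0; rewrite !(layer_cake _ mg g0 gM).
have mlev (r : R) : measurable [set x | r%:E < g x].
  by rewrite -[X in measurable X]setTI; exact: emeasurable_fun_o_infty.
have mmeas (m' : {finite_measure set T -> \bar R}) :
    measurable_fun `[0%R, M] (fun r : measurableTypeR R => m' [set x | r%:E < g x]).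
  have H : measurable [set p : measurableTypeR R * T | p.1%:E < g p.2].
    rewrite -[X in measurable X]setTI; apply: measurable_lte => //.
      exact/measurable_EFinP.
    exact: measurableT_comp.
  apply: measurable_funTS; rewrite (_ : (fun r => _) = m' \o xsection
      [set p : measurableTypeR R * T | p.1%:E < g p.2]).
    exact: measurable_fun_xsection.
  apply/funext => r; congr (m' _).
  by apply/seteqP; split => x /=; rewrite /xsection/= inE.
have -> : (M * b)%:E = \int[lebesgue_measure]_(r in `[0%R, M]) (cst b%:E r).
  rewrite integral_cst//= lebesgue_measure_itv/= lte_fin sube0 EFinM muleC.
  by move: M0; rewrite le_eqVlt => /predU1P[<-|->//]; rewrite ltxx.
rewrite -ge0_integralD//; last exact: mmeas.
apply: ge0_le_integral => //.
- exact: mmeas.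
- by apply: emeasurable_funD => //; exact: mmeas.
- move=> r /=; rewrite in_itv/= => /andP[r0 _]; apply: mn => // x /= rg.
  by apply: contrapT => /gD g0'; move: rg; rewrite g0' lte_fin ltNge r0.
Qed.

(** Replace the two copies of [m] by [n] one after the other. Each replacement
    integrates a marginal of [F] against [m - n], hence only the marginals of
    [F], and not [F] itself, have to be bounded. *)
Lemma le_integral_product_of_le_measure
    (m n : {finite_measure set T -> \bar R}) (D : set T) (b : R) :
  (forall B, measurable B -> B `<=` D -> m B <= n B + b%:E) ->
  (0 <= b)%R ->
  forall (F : T * T -> \bar R) (M : R), measurable_fun setT F ->
  (forall p, 0 <= F p) ->
  (forall x y, ~ (D x /\ D y) -> F (x, y) = 0) ->
  (forall x, \int[m]_y F (x, y) <= M%:E) ->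
  (forall y, \int[n]_x F (x, y) <= M%:E) -> (0 <= M)%R ->
  \int[m \x m]_p F p <= \int[n \x n]_p F p + (2 * (M * b))%:E.
Proof.
move=> mn b0 F M mF F0 FD Fm Fn M0.
rewrite mulr_natl mulr2n EFinD addeA.
rewrite fubini_tonelli1//.
apply: (@le_trans _ _ (\int[n]_x (\int[m]_y F (x, y)) + (M * b)%:E)).
  apply: (le_integral_of_le_measure mn) => //.
  - exact: measurable_fun_fubini_tonelli_F.
  - by move=> x; exact: integral_ge0.
  - by move=> x Dx; apply: integral0_eq => y _; apply: FD => -[].
rewrite leeD2r// fubini_tonelli// fubini_tonelli2//.
apply: (le_integral_of_le_measure mn) => //.
- exact: measurable_fun_fubini_tonelli_G.
- by move=> y; exact: integral_ge0.
- by move=> y Dy; apply: integral0_eq => x _; apply: FD => -[].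
Qed.

End measure_comparison.

Section integral_balance_gap.
Local Open Scope ereal_scope.
Context d (T : measurableType d) (R : realType).
Variables (m : {measure set T -> \bar R}) (D : set T).
Hypothesis mD : measurable D.

Let adde_cancel (x1 x2 a i1 i2 o1 o2 g : \bar R) :
  o1 \is a fin_num -> o2 \is a fin_num ->
  x1 + o1 = a + i1 -> x2 + o2 = a + i2 -> i1 + o2 <= i2 + o1 + g ->
  x1 <= x2 + g.
Proof.
move=> fin1 fin2 bal1 bal2 le_io.
rewrite -(@leeD2rE _ (o1 + o2)); last by rewrite fin_numD fin1.
have -> : x1 + (o1 + o2) = a + (i1 + o2) by rewrite addeA bal1 -addeA.
have -> : x2 + g + (o1 + o2) = a + (i2 + o1 + g).
  by rewrite [LHS](AC (2*2) ((1*4)*(3*2)))/= [X in X + _]bal2 -!addeA.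
exact: leeD2l.
Qed.

(** Comparison of two balance equations with the same starting value [a]:
    adding both outflows to each side avoids every subtraction, so that only
    the outflows need to be finite. *)
Lemma integral_balance_gap (i1 o1 i2 o2 g : T -> \bar R) (a x1 x2 : \bar R) :
  measurable_fun D i1 -> measurable_fun D o1 ->
  measurable_fun D i2 -> measurable_fun D o2 -> measurable_fun D g ->
  (forall s, D s -> 0 <= i1 s) -> (forall s, D s -> 0 <= o1 s) ->
  (forall s, D s -> 0 <= i2 s) -> (forall s, D s -> 0 <= o2 s) ->
  (forall s, D s -> 0 <= g s) ->
  (forall s, D s -> i1 s + o2 s <= i2 s + o1 s + g s) ->
  x1 + \int[m]_(s in D) o1 s = a + \int[m]_(s in D) i1 s ->
  x2 + \int[m]_(s in D) o2 s = a + \int[m]_(s in D) i2 s ->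
  \int[m]_(s in D) o1 s \is a fin_num ->
  \int[m]_(s in D) o2 s \is a fin_num ->
  x1 <= x2 + \int[m]_(s in D) g s.
Proof.
move=> mi1 mo1 mi2 mo2 mg i10 o10 i20 o20 g0 le_flow bal1 bal2 fin1 fin2.
have le_int : \int[m]_(s in D) i1 s + \int[m]_(s in D) o2 s <=
    \int[m]_(s in D) i2 s + \int[m]_(s in D) o1 s + \int[m]_(s in D) g s.
  rewrite -!ge0_integralD//; first last.
  - exact: emeasurable_funD.
  - by move=> s Ds; rewrite adde_ge0 ?i20 ?o10.
  apply: ge0_le_integral => //.
  - by move=> s Ds; rewrite adde_ge0 ?i10 ?o20.
  - exact: emeasurable_funD.
  - by apply: emeasurable_funD => //; exact: emeasurable_funD.
exact: adde_cancel fin1 fin2 bal1 bal2 le_int.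
Qed.

End integral_balance_gap.

Section finite_copy.
Context d (T : measurableType d) (R : realType).
Variable mu : {measure set T -> \bar R}.

(** The same set function, on which the structure of finite measure can be
    declared, as the Tonelli theorem requires. *)
Definition finite_copy of fin_num_fun mu : set T -> \bar R := mu.

HB.instance Definition _ h := Measure.copy (finite_copy h) mu.

HB.instance Definition _ h := @Measure_isFinite.Build d T R (finite_copy h) h.

End finite_copy.

Section finite_cover.
Local Open Scope ereal_scope.
Context d (T : measurableType d) (R : realType).

Lemma eq_measure_near_cover (m n : {measure set T -> \bar R}) (D : (set T)^nat) :
  (forall k, measurable (D k)) -> nondecreasing_seq D ->
  \bigcup_k D k = setT ->
  (\forall k \near \oo, forall A, measurable A -> A `<=` D k -> m A = n A) ->
  forall A, measurable A -> m A = n A.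
Proof.
move=> mD ndD covD mnD A mA.
have mAD k : measurable (A `&` D k) by exact: measurableI.
have cvgA (p : {measure set T -> \bar R}) :
    p (A `&` D k) @[k --> \oo] --> p A.
  rewrite -[X in _ --> p X](setIT A) -covD setI_bigcupr.
  apply: nondecreasing_cvg_mu => //; first exact: bigcupT_measurable.
  by move=> i j ij; apply/subsetPset; apply: setIS; exact/subsetPset/ndD.
apply: cvg_unique (cvgA m) _ => //.
apply: cvg_trans (cvgA n); apply: near_eq_cvg.
by apply: filterS mnD => k mnk; apply/esym/mnk => //; exact: subIsetr.
Qed.

End finite_cover.

Section integral_monomial.
Context {R : realType}.

Lemma integral_monomial (n : nat) (t : R) : 0 <= t ->
  (\int[lebesgue_measure]_(s in `[0%R, t]) (s ^+ n)%:E =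
  (t ^+ n.+1 / n.+1%:R)%:E)%E.
Proof.
rewrite le_eqVlt => /predU1P[<-|t0].
  by rewrite set_itv1 integral_set1 expr0n mul0r.
pose p : {poly R} := n.+1%:R^-1 *: 'X^(n.+1).
have pE s : p.[s] = s ^+ n.+1 / n.+1%:R by rewrite hornerZ hornerXn mulrC.
have dp (s : R) : is_derive s (1 : R) (horner p : R -> R) (s ^+ n).
  apply: is_derive_eq.
  rewrite derivZ derivXn hornerZ hornerMn hornerXn/=.
  by rewrite -[X in _ * X]mulr_natl mulKf.
have cp : continuous (horner p) by exact: continuous_horner.
rewrite (@continuous_FTC2 _ (fun s => s ^+ n) (horner p))//.
- by rewrite !pE expr0n mul0r sube0.
- by apply: continuous_subspaceT => s; exact: exprn_continuous.
- split.
  + by move=> s _; exact: ex_derive.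
  + by apply: cvg_at_right_filter; exact: cp.
  + by apply: cvg_at_left_filter; exact: cp.
- by move=> s _; rewrite derive1E derive_val.
Qed.
End integral_monomial.

Section integral_exp_coeff.
Local Open Scope ereal_scope.
Context {R : realType}.

(** One step of the Picard iteration behind the Gronwall lemma. *)
Lemma integral_exp_coeff (a b t : R) (n : nat) :
  (0 <= a)%R -> (0 <= b)%R -> (0 <= t)%R ->
  \int[lebesgue_measure]_(s in `[0%R, t]) (a * (b * exp_coeff (a * s) n))%:E =
  (b * exp_coeff (a * t) n.+1)%:E.
Proof.
move=> a0 b0 t0; pose w := (a * b * (a ^+ n / n`!%:R))%R.
transitivity (\int[lebesgue_measure]_(s in `[0%R, t]) (w%:E * (s ^+ n)%:E)).
  apply: eq_integral => s _; rewrite -EFinM; congr EFin.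
  by rewrite /w /exp_coeff/= exprMn; ring.
rewrite ge0_integralZl_EFin//; last 3 first.
- by move=> s; rewrite /= in_itv/= lee_fin => /andP[s0 _]; rewrite exprn_ge0.
- by apply/measurable_EFinP; exact: exprn_measurable.
- by rewrite /w !mulr_ge0// ?exprn_ge0// invr_ge0.
rewrite integral_monomial// -EFinM; congr EFin.
rewrite /w /exp_coeff/= exprMn !exprS factS natrM invfM.
by move: (n.+1%:R^-1)%R => h; ring.
Qed.

End integral_exp_coeff.

(** * Borel measures on a locally compact metric space *)

Section inner_distance.
Context {R : realType} {T : metricType R}.
Implicit Types (U : set T) (x y : T).

(** The distance to the complement of [U], capped at 1. Stated through balls
    contained in [U], it makes sense also when the complement is empty. *)
Definition inner_dist U x : R :=
  sup [set r : R | 0 <= r <= 1 /\ ball x r `<=` U].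

Let inner_dist_sup U x :
  has_sup [set r : R | 0 <= r <= 1 /\ ball x r `<=` U].
Proof.
split; last by exists 1 => r [/andP[]].
exists 0; split; first by rewrite lexx ler01.
by move=> y; rewrite ballEmdist/= ltNge mdist_ge0.
Qed.

Lemma inner_dist_ge U x r : 0 <= r <= 1 -> ball x r `<=` U ->
  r <= inner_dist U x.
Proof. by move=> r01 xrU; apply: ub_le_sup => //; case: (inner_dist_sup U x). Qed.

Lemma inner_dist_ge0 U x : 0 <= inner_dist U x.
Proof.
apply: inner_dist_ge; first by rewrite lexx ler01.
by move=> y; rewrite ballEmdist/= ltNge mdist_ge0.
Qed.

Lemma inner_dist_gt0 U x : open U -> U x -> 0 < inner_dist U x.
Proof.
move=> oU Ux; have /nbhs_ballP[e /= e0 xeU] : nbhs x U by exact: open_nbhs_nbhs.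
have m0 : 0 < Num.min e 1 by rewrite lt_min e0 ltr01.
apply: (lt_le_trans m0); apply: inner_dist_ge.
  by rewrite ltW//= ge_min lexx orbT.
by apply: subset_trans xeU; apply: le_ball; rewrite ge_min lexx.
Qed.

Lemma inner_dist_eq0 U x : ~ U x -> inner_dist U x = 0.
Proof.
move=> Ux; apply/eqP; rewrite eq_le inner_dist_ge0 andbT.
apply: ge_sup; first by case: (inner_dist_sup U x).
move=> r [_ xrU]; rewrite leNgt; apply/negP => r0.
by apply/Ux/xrU; exact: ballxx.
Qed.

(** A ball of radius [r] around [x] contains the ball of radius
    [r - mdist x y] around [y]. *)
Lemma inner_dist_lipschitz U x y :
  inner_dist U x <= inner_dist U y + mdist x y.
Proof.
apply: ge_sup; first by case: (inner_dist_sup U x).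
move=> r [/andP[r0 r1] xrU]; rewrite -lerBlDr.
have [rxy|/ltW rxy] := leP (r - mdist x y) 0.
  by rewrite (le_trans rxy)// inner_dist_ge0.
apply: inner_dist_ge; first by rewrite rxy/= lerBlDr ler_wpDr// mdist_ge0.
move=> z; rewrite ballEmdist/= => yz; apply: xrU; rewrite ballEmdist/=.
by rewrite (le_lt_trans (metric_triangle x y z))// -ltrBrDl.
Qed.

Lemma continuous_inner_dist U : continuous (inner_dist U).
Proof.
move=> x; apply/cvgrPdist_lt => e e0; near=> y.
have xye : mdist x y < e.
  near: y; apply/nbhs_ballP; exists e => //= y.
  by rewrite ballEmdist.
rewrite ltr_norml ltrBlDr ltrNl opprB ltrBlDr.
rewrite (le_lt_trans (inner_dist_lipschitz U y x)) ?(metric_sym y x)//=.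
  by rewrite (le_lt_trans (inner_dist_lipschitz U x y))// addrC ltrD2r.
by rewrite addrC ltrD2r.
Unshelve. all: by end_near. Qed.

(** Continuous functions supported in [U] that increase to its indicator. *)
Definition cutoff U (n : nat) x : R := Num.min 1 (n%:R * inner_dist U x).

Lemma cutoff_ge0 U n x : 0 <= cutoff U n x.
Proof. by rewrite le_min ler01 mulr_ge0// inner_dist_ge0. Qed.

Lemma continuous_cutoff U n : continuous (cutoff U n).
Proof.
move=> x; apply: (@continuous_min _ _ (cst 1) (fun x => n%:R * inner_dist U x)).
  exact: cvg_cst.
by apply: cvgM; [exact: cvg_cst|exact: continuous_inner_dist].
Qed.

Lemma cutoff_eq0 U n x : ~ U x -> cutoff U n x = 0.
Proof. by move=> Ux; rewrite /cutoff inner_dist_eq0// mulr0 min_r. Qed.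

Lemma nondecreasing_cutoff U x : nondecreasing_seq (cutoff U ^~ x).
Proof.
move=> m n mn; rewrite /cutoff le_min2// ler_wpM2r ?inner_dist_ge0//.
by rewrite ler_nat.
Qed.

Lemma near_cutoff_eq1 U x : open U -> U x -> \forall n \near \oo, cutoff U n x = 1.
Proof.
move=> oU Ux; have h0 := inner_dist_gt0 oU Ux; near=> n.
rewrite /cutoff min_l// -ler_pdivrMr// mul1r.
near: n; exact: nbhs_infty_ger.
Unshelve. all: by end_near. Qed.

End inner_distance.

Section test_functions.
Context {R : realType} {d : measure_display} {E : metricMeasurableType R d}.
Implicit Types (f g : E -> R) (U V C : set E).

Lemma compactly_supportedP f C : continuous f -> compact C ->
  [set x | f x != 0] `<=` C -> compactly_supported_continuous f.
Proof.
move=> cf cC fC; split => //.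
have clC : closed C by apply: compact_closed => //; exact: metric_hausdorff.
apply: (subclosed_compact _ cC); first exact: closed_closure.
by move/closure_id: clC => ->; exact: closureS.
Qed.

Lemma compactly_supportedD f g : compactly_supported_continuous f ->
  compactly_supported_continuous g -> compactly_supported_continuous (f \+ g).
Proof.
move=> [cf kf] [cg kg]; apply: (compactly_supportedP _ (compactU kf kg)).
  by move=> x; apply: cvgD; [exact: cf|exact: cg].
move=> x /= fg0; have [fx|fx] := eqVneq (f x) 0.
  by right; apply: subset_closure => /=; move: fg0; rewrite fx add0r.
by left; exact: subset_closure.
Qed.

Lemma compactly_supported_cutoff U n : compact (closure U) ->
  compactly_supported_continuous (cutoff U n).
Proof.
move=> cU; apply: (compactly_supportedP _ cU); first exact: continuous_cutoff.
move=> x /= fx; apply: subset_closure; apply: contrapT => /(cutoff_eq0 n) f0.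
by rewrite f0 eqxx in fx.
Qed.

Hypothesis E_borel : borel_sigma_algebra E.

Lemma open_measurable_borel U : open U -> measurable U.
Proof. by rewrite E_borel => oU; exact: sub_sigma_algebra. Qed.

Lemma compact_measurable_borel C : compact C -> measurable C.
Proof.
move=> cC; rewrite -(setCK C); apply: measurableC; apply: open_measurable_borel.
by apply: closed_openC; apply: compact_closed => //; exact: metric_hausdorff.
Qed.

Lemma continuous_measurable_borel f : continuous f -> measurable_fun setT f.
Proof.
move=> /continuousP cf.
apply: (measurability _ (RGenOInfty.measurableE R)) => _ [_ [x ->] <-].
by rewrite setTI; apply: open_measurable_borel; apply: cf; exact: interval_open.
Qed.

Hypothesis lcE : locally_compact [set: E].

(** Every point has a neighbourhood on which some test function is at least 1;
    sum finitely many of these functions. *)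
Lemma compact_dominated C : compact C -> exists f, exists2 U, open U &
  [/\ compactly_supported_continuous f, forall y, 0 <= f y, C `<=` U &
      forall y, U y -> 1 <= f y].
Proof.
rewrite compact_cover => cC.
have loc x : exists fU : (E -> R) * set E,
    [/\ compactly_supported_continuous fU.1, forall y, 0 <= fU.1 y, open fU.2,
        fU.2 x & forall y, fU.2 y -> 1 <= fU.1 y].
  have [V] := lcE (I : setT x); rewrite withinET /= => xV.
  move=> pV; pose W := V°; have oW : open W by exact: open_interior.
  have clW : compact (closure W).
    by rewrite -precompactE; exists V => //; exact: interior_subset.
  have Wx : W x by exact: xV.
  have [n _ /(_ n (leqnn n)) n1] := near_cutoff_eq1 oW Wx.
  (* The cutoff equals 1 at x but possibly nowhere else: doubling it makes it
     at least 1 on a neighbourhood of x. *)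
  exists (fun y => 2 * cutoff W n y, [set y | 2^-1 < cutoff W n y]) => /=.
  have cW : continuous (cutoff W n) := @continuous_cutoff R E W n; split.
  - apply: (compactly_supportedP _ clW).
      by move=> y; apply: cvgM; [exact: cvg_cst|exact: cW].
    move=> y /=; rewrite mulf_eq0 negb_or => /andP[_ fy].
    apply: subset_closure; apply: contrapT => /(cutoff_eq0 n) f0.
    by rewrite f0 eqxx in fy.
  - by move=> y; rewrite mulr_ge0// cutoff_ge0.
  - by move/continuousP: cW => /(_ [set r | 2^-1 < r]); apply; exact: open_gt.
  - by rewrite n1 invf_lt1// ltr1n.
  - by move=> y /ltW; rewrite -ler_pdivrMl// mulr1.
have [fU fUP] := choice loc.
have [||s _ Cs] := cC E setT (fun x => (fU x).2).
- by move=> x _; have [] := fUP x.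
- by move=> x _; exists x => //; have [] := fUP x.
have [f [cf f0 f1]] : exists f, [/\ compactly_supported_continuous f,
    forall y, 0 <= f y & forall x, x \in finmap.enum_fset s ->
      forall y, (fU x).2 y -> 1 <= f y].
  elim: (finmap.enum_fset s) => [|x r [f [cf f0 f1]]].
    exists (cst 0); split => //; apply: (compactly_supportedP _ compact0).
      by move=> y; exact: cvg_cst.
    by move=> y /=; rewrite eqxx.
  have [cx x0 _ _ x1] := fUP x.
  exists ((fU x).1 \+ f); split; first exact: compactly_supportedD.
    by move=> y; rewrite addr_ge0.
  move=> z; rewrite in_cons => /predU1P[->|zr] y yU /=.
    by rewrite ler_wpDr// x1.
  by rewrite ler_wpDl// (f1 z).
exists f; exists (cover [set x | x \in finmap.enum_fset s] (fun x => (fU x).2)).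
  by apply: bigcup_open => x _; have [] := fUP x.
by split => // y [x xs /=]; exact: f1.
Qed.

End test_functions.

Section measure_from_test_functions.
Local Open Scope ereal_scope.
Context {R : realType} {d : measure_display} {E : metricMeasurableType R d}.
Hypothesis E_borel : borel_sigma_algebra E.
Hypothesis E_sigma_compact : sigma_compact E.
Hypothesis lcE : locally_compact [set: E].

Let measurable_test (f : E -> R) : compactly_supported_continuous f ->
  measurable_fun setT (EFin \o f).
Proof.
by case=> cf _; apply/measurable_EFinP; exact: continuous_measurable_borel.
Qed.

Lemma lt_pinfty_of_dominated (m : {measure set E -> \bar R}) (U : set E)
    (f : E -> R) : compactly_supported_continuous f ->
  (forall x, 0 <= f x)%R -> open U -> (forall x, U x -> 1 <= f x)%R ->
  \int[m]_x (f x)%:E < +oo -> m U < +oo.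
Proof.
move=> cf f0 oU Uf; apply: le_lt_trans.
have mU : measurable U by exact: open_measurable_borel.
rewrite -(setIT U) -integral_indic//; apply: ge0_le_integral => //.
- exact/measurable_EFinP.
- exact: measurable_test.
- move=> x _; rewrite lee_fin indicE.
  by case: (boolP (x \in U)) => [/[!inE]/Uf|].
Qed.

Lemma compact_measure_lt_pinfty (m : {measure set E -> \bar R}) (C : set E) :
  (forall f, compactly_supported_continuous f -> (forall x, 0 <= f x)%R ->
    \int[m]_x (f x)%:E < +oo) -> compact C -> m C < +oo.
Proof.
move=> mfin cC; have [f [U oU [cf f0 CU Uf]]] := compact_dominated lcE cC.
apply: (@le_lt_trans _ _ (m U)).
  apply: le_measure => //; rewrite inE; first exact: compact_measurable_borel.
  exact: open_measurable_borel.
by apply: (lt_pinfty_of_dominated cf) => //; exact: mfin.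
Qed.

Lemma cvg_integral_cutoff (m : {measure set E -> \bar R}) (U : set E) :
  open U -> \int[m]_x (cutoff U n x)%:E @[n --> \oo] --> m U.
Proof.
move=> oU; have mU : measurable U by exact: open_measurable_borel.
rewrite [X in _ --> X](_ : _ = \int[m]_x (\1_U x)%:E); last first.
  by rewrite integral_indicT.
rewrite (eq_integral (fun x => limn (fun n => (cutoff U n x)%:E))); last first.
  move=> x _; apply/esym/cvg_lim => //; rewrite indicE.
  have [Ux|Ux] := pselect (U x); apply: cvg_near_cst.
    by rewrite mem_set//; move/(near_cutoff_eq1 oU): Ux; apply: filterS => n ->.
  by apply: nearW => n; rewrite memNset// cutoff_eq0.
apply: (@cvg_monotone_convergence _ _ _ m setT measurableT
  (fun n x => (cutoff U n x)%:E)) => //.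
- move=> n; apply/measurable_EFinP; apply: continuous_measurable_borel => //.
  exact: continuous_cutoff.
- by move=> n x _; rewrite lee_fin cutoff_ge0.
- by move=> x _ a b ab; rewrite lee_fin; exact: nondecreasing_cutoff.
Qed.

(** The relatively compact open sets of finite measure are stable under
    intersection, cover the space countably many at a time, and generate the
    Borel sets; on each of them both measures are the limit of the integrals of
    its cutoffs. *)
Lemma eq_measure_test_functions (m1 m2 : {measure set E -> \bar R}) :
  (forall f, compactly_supported_continuous f -> (forall x, 0 <= f x)%R ->
    \int[m1]_x (f x)%:E = \int[m2]_x (f x)%:E) ->
  (forall f, compactly_supported_continuous f -> (forall x, 0 <= f x)%R ->
    \int[m1]_x (f x)%:E < +oo) ->
  forall A, measurable A -> m1 A = m2 A.
Proof.
move=> m12 mfin; have [F cF F_cover] := E_sigma_compact.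
pose G := [set U : set E | [/\ open U, compact (closure U) & m1 U < +oo]].
have [g gP] := choice (fun n => compact_dominated lcE (cF n)).
have {gP} [V VP] := choice (fun n =>
  let: ex_intro2 U oU P := gP n in ex_intro _ U (conj oU P)).
have GV n : G (V n).
  have [oV [[cg kg] g0 FV Vg]] := VP n; split => //.
  - apply: (subclosed_compact _ kg); first exact: closed_closure.
    apply: closureS => x /Vg g1 /=.
    by rewrite gt_eqF// (lt_le_trans _ g1).
  - by apply: (lt_pinfty_of_dominated (conj cg kg)) => //; exact: mfin.
have Gsub U W : open W -> G U -> G (U `&` W).
  move=> oW [oU cU Ufin]; split.
  - exact: openI.
  - apply: (subclosed_compact _ cU); first exact: closed_closure.
    exact: closureS.
  - apply: le_lt_trans Ufin; apply: le_measure => //.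
      by rewrite inE; apply: open_measurable_borel => //; exact: openI.
    by rewrite inE; exact: open_measurable_borel.
have Gmeas : G `<=` measurable.
  by move=> U [oU _ _]; exact: open_measurable_borel.
have V_cover : \bigcup_n V n = setT.
  rewrite -subTset -F_cover => x [n _ Fx]; exists n => //.
  by have [_ [_ _ FV _]] := VP n; exact: FV.
have mG (A : set E) : measurable A -> <<s G >> A.
  rewrite E_borel; move: A; apply: smallest_sub.
    exact: smallest_sigma_algebra.
  move=> U oU; rewrite -(setTI U) -V_cover setI_bigcupl.
  apply: sigma_algebra_bigcup => n; apply: sub_sigma_algebra.
  exact: Gsub.
move=> A /mG; apply: (@g_sigma_algebra_measure_unique _ _ _ _ Gmeas V GV) => //.
- by move=> U W GU [oW _ _]; exact: Gsub.
- move=> U [oU cU _].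
  apply: cvg_unique (cvg_integral_cutoff (m := m1) oU) _ => //.
  rewrite (_ : (fun n => _) = fun n => \int[m2]_x (cutoff U n x)%:E).
    exact: cvg_integral_cutoff.
  apply/funext => n; apply: m12; last by move=> x; exact: cutoff_ge0.
  exact: compactly_supported_cutoff.
- by move=> n; have [] := GV n.
Qed.

End measure_from_test_functions.

Section represented_uniqueness.
Local Open Scope ereal_scope.
Context {R : realType} {d : measure_display} {E : metricMeasurableType R d}.
Hypothesis E_borel : borel_sigma_algebra E.
Hypothesis E_sigma_compact : sigma_compact E.
Hypothesis lcE : locally_compact [set: E].

Variables I J : (E -> \bar R) -> \bar R.
Hypotheses (rI : represented I) (rJ : represented J).
Hypothesis IJ : forall f, compactly_supported_continuous f ->
  (forall x, 0 <= f x)%R -> I (EFin \o f) = J (EFin \o f).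
Hypothesis Ifin : forall f, compactly_supported_continuous f ->
  (forall x, 0 <= f x)%R -> I (EFin \o f) < +oo.

Let measurable_test (f : E -> R) : compactly_supported_continuous f ->
  measurable_fun setT (EFin \o f).
Proof.
by case=> cf _; apply/measurable_EFinP; exact: continuous_measurable_borel.
Qed.

Lemma represented_indic_lt_pinfty (C : set E) : compact C ->
  I (fun x => (\1_C x)%:E) < +oo.
Proof.
move=> cC; have [m mE] := rI; have mC := compact_measurable_borel E_borel cC.
rewrite mE//; last exact: measurable_EFin_indic.
rewrite integral_indicT//; apply: (compact_measure_lt_pinfty E_borel lcE) => // f cf f0.
by have := Ifin cf f0; rewrite mE//; exact: measurable_test.
Qed.

(** The passage from test functions to sets: agreement on functions that are
    continuous with compact support is agreement of two Borel measures. *)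
Lemma represented_eq_indic (A : set E) : measurable A ->
  I (fun x => (\1_A x)%:E) = J (fun x => (\1_A x)%:E).
Proof.
move=> mA; have [[m mE] [n nE]] := (rI, rJ).
have m1A := @measurable_EFin_indic _ _ R _ mA.
rewrite mE ?nE//.
rewrite !integral_indicT//; apply: (eq_measure_test_functions E_borel) => // f cf f0.
  rewrite -[LHS]mE ?(IJ cf f0) ?nE//; exact: measurable_test.
by have := Ifin cf f0; rewrite mE//; exact: measurable_test.
Qed.

End represented_uniqueness.

(** * The balance equation of a solution *)

Section time_measurability.
Local Open Scope ereal_scope.
Context {R : realType} {d : measure_display} {E : measurableType d}.
Variable u : R -> {finite_measure set E -> \bar R}.
Hypothesis mu : forall A : set E, measurable A ->
  measurable_fun (`[0%R, +oo[ : set R) (fun t => u t A).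

(* Freezing the family before time 0 makes it a kernel on the whole line. *)
Let v (s : measurableTypeR R) : {finite_measure set E -> \bar R} :=
  u (Order.max s 0%R).

Let mv A : measurable A -> measurable_fun setT (fun s => v s A).
Proof.
move=> mA; apply: (measurable_comp (F := `[0%R, +oo[ : set R) _ _ (mu mA)) => //.
  by move=> _ [s _ <-]; rewrite /= in_itv/= andbT le_max lexx orbT.
exact: measurable_maxr.
Qed.

Let vE (s : R) : s \in `[0%R, +oo[%classic -> v s = u s.
Proof. by rewrite inE /= in_itv/= andbT => s0; rewrite /v max_l. Qed.

Lemma measurable_time_integral (f : measurableTypeR R * E -> \bar R) :
  (forall s x, (0 <= s)%R -> 0 <= f (s, x)) ->
  measurable_fun setT f ->
  measurable_fun (`[0%R, +oo[ : set R) (fun s => \int[u s]_x f (s, x)).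
Proof.
move=> f0 mf; pose g p : \bar R := f (Order.max p.1 0%R, p.2).
have mg : measurable_fun setT g.
  apply: (measurableT_comp mf); apply: measurable_fun_pair => //.
  exact: measurable_maxr.
have := @measurable_fun_integral_transition _ _ _ _ R v g mv.
move=> /(_ _ _ mg) H.
apply: (@eq_measurable_fun _ _ _ _ _ (fun s => \int[v s]_x g (s, x))).
  move=> s s0; rewrite vE//; apply: eq_integral => x _; rewrite /g/= max_l//.
  by move: s0; rewrite inE /= in_itv/= andbT.
apply: measurable_funTS; apply: H.
  by move=> s; rewrite -ge0_fin_numE// fin_num_measure.
by case=> s x; apply: f0; rewrite le_max lexx orbT.
Qed.

Lemma measurable_time_section (f : E * E -> \bar R) :
  (forall p, 0 <= f p) -> measurable_fun setT f ->
  measurable_fun setT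
    (fun q : measurableTypeR R * E => \int[v q.1]_x f (x, q.2)).
Proof.
move=> f0 mf.
apply: (@measurable_fun_integral_transition _ _ (measurableTypeR R * E)%type E R
  (fun q => v q.1) (fun q => f (q.2, q.1.2))) => //.
- by move=> U mU; exact: (measurableT_comp (mv mU)).
- by move=> q; rewrite -ge0_fin_numE// fin_num_measure.
- apply: (measurableT_comp mf); apply: measurable_fun_pair => //.
  exact: measurableT_comp.
Qed.

Lemma measurable_time_product (f : E * E -> \bar R) :
  (forall p, 0 <= f p) -> measurable_fun setT f ->
  measurable_fun (`[0%R, +oo[ : set R) (fun s => \int[u s \x u s]_p f p).
Proof.
move=> f0 mf.
apply: (@eq_measurable_fun _ _ _ _ _
  (fun s => \int[u s]_y \int[v s]_x f (x, y))).
  by move=> s s0; rewrite vE// fubini_tonelli2.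
apply: measurable_time_integral (measurable_time_section f0 mf) => s x _.
exact: integral_ge0.
Qed.

Lemma measurable_time_product_fixed (m : {finite_measure set E -> \bar R})
    (f : E * E -> \bar R) :
  (forall p, 0 <= f p) -> measurable_fun setT f ->
  measurable_fun (`[0%R, +oo[ : set R) (fun s => \int[m \x u s]_p f p).
Proof.
move=> f0 mf.
apply: (@eq_measurable_fun _ _ _ _ _
  (fun s => \int[u s]_y \int[m]_x f (x, y))).
  by move=> s s0; rewrite fubini_tonelli2.
apply: (measurable_time_integral (f := fun q => \int[m]_x f (x, q.2))).
  by move=> s x _; exact: integral_ge0.
apply: (measurableT_comp (f := fun y => \int[m]_x f (x, y))) => //.
exact: measurable_fun_fubini_tonelli_G.
Qed.

End time_measurability.

Section balance.
Local Open Scope ereal_scope.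
Context {R : realType} {d : measure_display} {E : metricMeasurableType R d}.
Variables (K : R.-ker (E * E) ~> E) (phi : E * E -> R).
Hypothesis K_fin : forall x y, total_rate K x y < +oo.
Hypothesis mphi : measurable_fun setT phi.
Hypothesis phi_ge0 : forall p, (0 <= phi p)%R.
Variable u0 : {finite_measure set E -> \bar R}.
Implicit Types (u v : {finite_measure set E -> \bar R}) (F : E -> \bar R).

(** The terms of the Flory equation, for a nonnegative function [F], regrouped
    so that all of them are nonnegative: the loss through collisions with [u]
    and the influence of [u0] reduce [u], whereas the gain and the correction
    by [phi] against [u] itself, which enters the loss with a minus sign,
    increase it. *)
Definition outflow u F :=
  \int[u \x u]_p (F p.2 * total_rate K p.1 p.2) +
  \int[u0 \x u]_p (F p.2 * (phi p)%:E).

Definition inflow u F :=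
  (2^-1)%R%:E * \int[u \x u]_p \int[K p]_z F z +
  \int[u \x u]_p (F p.2 * (phi p)%:E).

Lemma measurable_total_rate :
  measurable_fun setT (fun p : E * E => total_rate K p.1 p.2).
Proof.
by under eq_fun do rewrite /total_rate -surjective_pairing;
  exact: measurable_kernel.
Qed.

Let measurable_rate F : measurable_fun setT F ->
  measurable_fun setT (fun p : E * E => F p.2 * total_rate K p.1 p.2).
Proof.
move=> mF; apply: emeasurable_funM; last exact: measurable_total_rate.
exact: measurableT_comp.
Qed.

Let measurable_phi F : measurable_fun setT F ->
  measurable_fun setT (fun p : E * E => F p.2 * (phi p)%:E).
Proof.
move=> mF; apply: emeasurable_funM; last exact/measurable_EFinP.
exact: measurableT_comp.
Qed.

Let measurable_gain F : (forall x, 0 <= F x) -> measurable_fun setT F ->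
  measurable_fun setT (fun p => \int[K p]_z F z).
Proof.
by move=> F0 mF; apply: measurable_fun_integral_kernel => // U;
  exact: measurable_kernel.
Qed.

Lemma outflow_ge0 u F : (forall x, 0 <= F x) -> 0 <= outflow u F.
Proof.
by move=> F0; apply: adde_ge0; apply: integral_ge0 => p _;
  rewrite mule_ge0// lee_fin.
Qed.

Lemma inflow_ge0 u F : (forall x, 0 <= F x) -> 0 <= inflow u F.
Proof.
move=> F0; apply: adde_ge0; last first.
  by apply: integral_ge0 => p _; rewrite mule_ge0// lee_fin.
rewrite mule_ge0 ?lee_fin//.
by apply: integral_ge0 => p _; exact: integral_ge0.
Qed.

Section solution.
Variable u : R -> {finite_measure set E -> \bar R}.
Hypothesis mu : forall A : set E, measurable A ->
  measurable_fun (`[0%R, +oo[ : set R) (fun t => u t A).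

Lemma measurable_outflow F : (forall x, 0 <= F x) -> measurable_fun setT F ->
  measurable_fun (`[0%R, +oo[ : set R) (fun s => outflow (u s) F).
Proof.
move=> F0 mF; apply: emeasurable_funD.
  apply: measurable_time_product => //; last exact: measurable_rate.
  by move=> p; rewrite mule_ge0.
apply: measurable_time_product_fixed => //; last exact: measurable_phi.
by move=> p; rewrite mule_ge0// lee_fin.
Qed.

Lemma measurable_inflow F : (forall x, 0 <= F x) -> measurable_fun setT F ->
  measurable_fun (`[0%R, +oo[ : set R) (fun s => inflow (u s) F).
Proof.
move=> F0 mF; apply: emeasurable_funD.
  apply: measurable_funeM; apply: measurable_time_product => //.
    by move=> p; exact: integral_ge0.
  exact: measurable_gain.
apply: measurable_time_product => //; last exact: measurable_phi.
by move=> p; rewrite mule_ge0// lee_fin.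
Qed.

Let D_ge0 (t : R) : (`[0%R, t] : set R)%classic `<=` `[0%R, +oo[%classic.
Proof. by move=> s; rewrite /= !in_itv/= andbT => /andP[]. Qed.

Let measurable_on (t : R) (f : R -> \bar R) :
  measurable_fun (`[0%R, +oo[ : set R) f -> measurable_fun (`[0%R, t] : set R) f.
Proof. by apply: measurable_funS => //; exact: D_ge0. Qed.

Lemma represented_outflow t : represented (fun F =>
  \int[u t]_x F x + \int[lebesgue_measure]_(s in `[0%R, t]) outflow (u s) F).
Proof.
apply: represented_add; first exact: represented_integral.
apply: represented_mixture => //.
  move=> s; apply: represented_add.
    apply: represented_mixture => //.
      move=> p; apply: represented_eval => //.
      by rewrite ge0_fin_numE.
    by move=> A mA; exact: measurable_rate (measurable_EFin_indic mA).
  apply: represented_mixture => //.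
    by move=> p; apply: represented_eval => //; rewrite lee_fin.
  by move=> A mA; exact: measurable_phi (measurable_EFin_indic mA).
move=> A mA; apply: measurable_on; apply: measurable_outflow.
  by move=> x; rewrite lee_fin.
exact: measurable_EFin_indic.
Qed.

Lemma represented_inflow t : represented (fun F =>
  \int[u0]_x F x + \int[lebesgue_measure]_(s in `[0%R, t]) inflow (u s) F).
Proof.
apply: represented_add; first exact: represented_integral.
apply: represented_mixture => //.
  move=> s; apply: represented_add.
    have h0 : (0 <= 2^-1 :> R)%R by [].
    apply: (represented_scale (NngNum h0)).
    apply: represented_mixture => //.
      by move=> p; exact: represented_integral.
    move=> A mA; apply: measurable_gain; last exact: measurable_EFin_indic.
    by move=> x; rewrite lee_fin.
  apply: represented_mixture => //.
    by move=> p; apply: represented_eval => //; rewrite lee_fin.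
  by move=> A mA; exact: measurable_phi (measurable_EFin_indic mA).
move=> A mA; apply: measurable_on; apply: measurable_inflow.
  by move=> x; rewrite lee_fin.
exact: measurable_EFin_indic.
Qed.

End solution.

End balance.

Section balance_of_solution.
Local Open Scope ereal_scope.
Context {R : realType} {d : measure_display} {E : metricMeasurableType R d}.
Hypothesis E_borel : borel_sigma_algebra E.
Variables (K : R.-ker (E * E) ~> E) (phi : E * E -> R).
Hypothesis mphi : measurable_fun setT phi.
Hypothesis phi_ge0 : forall p, (0 <= phi p)%R.
Variable u0 : {finite_measure set E -> \bar R}.
Hypothesis Phi_fin : forall y, \int[u0]_x (phi (x, y))%:E < +oo.
Variable u : R -> {finite_measure set E -> \bar R}.
Hypothesis sol : flory_solution K phi u0 u.

Let mu := flory_measurable sol.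

Let integral_section (m : {measure set E -> \bar R}) (y : E) :=
  \int[m]_x (phi (x, y))%:E.

Let section_ge0 m y : 0 <= integral_section m y.
Proof. by apply: integral_ge0 => x _; rewrite lee_fin. Qed.

Let measurable_section (m : {finite_measure set E -> \bar R}) :
  measurable_fun setT (integral_section m).
Proof.
apply: (measurable_fun_fubini_tonelli_G (EFin \o phi)).
- exact/measurable_EFinP.
- by move=> p; rewrite lee_fin.
Qed.

Lemma test_function_fin_num (m : {finite_measure set E -> \bar R}) (f : E -> R) :
  compactly_supported_continuous f -> (forall x, (0 <= f x)%R) ->
  \int[m]_x (f x)%:E \is a fin_num.
Proof.
move=> [cf kf] f0.
have mf : measurable_fun setT (EFin \o f).
  by apply/measurable_EFinP; exact: continuous_measurable_borel.
rewrite ge0_fin_numE; last by apply: integral_ge0 => x _; rewrite lee_fin.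
have [M Mf] : exists M : R, forall x, (f x <= M)%R.
  have /compact_bounded[M [Mreal Mf]] :
      compact (f @` closure [set x | f x != 0%R]).
    by apply: continuous_compact => //; exact: continuous_subspaceT.
  exists (Order.max 0 (M + 1))%R => x; rewrite le_max.
  have [->|fx0] := eqVneq (f x) 0%R; first by rewrite lexx.
  apply/orP; right; apply: le_trans (ler_norm _) _.
  apply: (Mf (M + 1)%R); first by rewrite ltrDl.
  by exists x => //; exact: subset_closure.
apply: (@le_lt_trans _ _ (\int[m]_x (cst M%:E x))).
  apply: ge0_le_integral => //.
  - by move=> x _; rewrite lee_fin.
  - by move=> x _; rewrite lee_fin.
rewrite integral_cst// lte_mul_pinfty//; last first.
  by rewrite -ge0_fin_numE// fin_num_measure.
by rewrite lee_fin; apply: le_trans (Mf point).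
Qed.

(** The two halves of the phi-loss may be integrated separately once the first
    one is finite, since the conserved quantity bounds the second one by the
    first one. *)
Lemma phi_loss_split (s : R) (f : E -> R) : (0 <= s)%R ->
  measurable_fun setT f -> (forall x, (0 <= f x)%R) ->
  \int[u0 \x u s]_p ((f p.2)%:E * (phi p)%:E) < +oo ->
  \int[u s]_y ((f y)%:E *
    (integral_section u0 y - integral_section (u s) y)) =
  \int[u0 \x u s]_p ((f p.2)%:E * (phi p)%:E) -
  \int[u s \x u s]_p ((f p.2)%:E * (phi p)%:E) /\
  \int[u s \x u s]_p ((f p.2)%:E * (phi p)%:E) \is a fin_num.
Proof.
move=> s0 mf f0.
have mF : measurable_fun setT (EFin \o f) by exact/measurable_EFinP.
have pairE (m : {finite_measure set E -> \bar R}) :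
    \int[m \x u s]_p ((f p.2)%:E * (phi p)%:E) =
    \int[u s]_y ((f y)%:E * integral_section m y).
  rewrite fubini_tonelli2//.
  - apply: eq_integral => y _; rewrite /fubini_G/= ge0_integralZl//.
    + by apply/measurable_EFinP; exact: measurableT_comp mphi _.
    + by move=> x _; rewrite lee_fin.
    + by rewrite lee_fin.
  - apply: emeasurable_funM; last exact/measurable_EFinP.
    exact: (measurableT_comp mF).
  - by move=> p; rewrite mule_ge0 ?lee_fin.
have mprod (m : {finite_measure set E -> \bar R}) :
    measurable_fun setT (fun y => (f y)%:E * integral_section m y).
  exact: emeasurable_funM.
have prod_ge0 m y : 0 <= (f y)%:E * integral_section m y.
  by rewrite mule_ge0// lee_fin.
have le_sec y : integral_section (u s) y <= integral_section u0 y.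
  exact: (flory_conserved_le sol).
rewrite !pairE => pfin.
have qfin : \int[u s]_y ((f y)%:E * integral_section (u s) y) < +oo.
  apply: le_lt_trans pfin; apply: ge0_le_integral => // y _.
  by rewrite lee_wpmul2l// lee_fin.
split; last by rewrite ge0_fin_numE//; exact: integral_ge0.
rewrite -integralB//; last 2 first.
- by apply/integrableP; split => //; under eq_integral do rewrite gee0_abs//.
- by apply/integrableP; split => //; under eq_integral do rewrite gee0_abs//.
apply: eq_integral => y _; rewrite muleBr//.
rewrite fin_num_adde_defl// fin_numN ge0_fin_numE//.
exact: le_lt_trans (le_sec y) (Phi_fin y).
Qed.

Let sube_rearrange (g x y z : \bar R) : 0 <= g ->
  x \is a fin_num -> y \is a fin_num -> z \is a fin_num ->
  g - (x + (y - z)) = (g + z) - (x + y).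
Proof.
move: g x y z => [g||] [x||] [y||] [z||]//= _ _ _ _.
rewrite -!EFinD; congr EFin; rewrite !opprD opprK -[RHS]addrA; congr (_ + _)%R.
by rewrite [RHS]addrC addrA.
Qed.

(** At almost every time the outflow is finite, and then the right-hand side of
    the Flory equation is the inflow minus the outflow. The time integral of
    this difference is finite because the equation itself says so; therefore
    the gain, on which no integrability is assumed, has a finite integral. *)
Lemma balance_test_function (f : E -> R) (t : R) : (0 <= t)%R ->
  compactly_supported_continuous f -> (forall x, (0 <= f x)%R) ->
  \int[u t]_x (f x)%:E +
  \int[lebesgue_measure]_(s in `[0%R, t]) outflow K phi u0 (u s) (EFin \o f) =
  \int[u0]_x (f x)%:E +
  \int[lebesgue_measure]_(s in `[0%R, t]) inflow K phi (u s) (EFin \o f) /\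
  \int[u t]_x (f x)%:E +
  \int[lebesgue_measure]_(s in `[0%R, t]) outflow K phi u0 (u s) (EFin \o f)
    < +oo.
Proof.
move=> t0 test_f f0; have F0 x : 0 <= (EFin \o f) x by rewrite lee_fin.
have mf : measurable_fun setT f by exact: continuous_measurable_borel test_f.1.
have mF : measurable_fun setT (EFin \o f) by exact/measurable_EFinP.
pose D : set R := `[0%R, t]%classic.
have Dge0 s : D s -> (0 <= s)%R by rewrite /D/= in_itv/= => /andP[].
have DT : D `<=` `[0%R, +oo[%classic.
  by move=> s /Dge0; rewrite /= in_itv/= andbT.
have mD : measurable D by exact: measurable_itv.
have mrate : measurable_fun setT
    (fun p : E * E => (f p.2)%:E * total_rate K p.1 p.2).
  apply: emeasurable_funM; last exact: measurable_total_rate.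
  exact: (measurableT_comp mF).
have mpair : measurable_fun setT (fun p : E * E => (f p.2)%:E * (phi p)%:E).
  apply: emeasurable_funM; last exact/measurable_EFinP.
  exact: (measurableT_comp mF).
have rate_ge0 p : 0 <= (f p.2)%:E * total_rate K p.1 p.2 
  by rewrite mule_ge0 ?lee_fin//.
have pair_ge0 (p : E * E) : 0 <= (f p.2)%:E * (phi p)%:E.
  by rewrite mule_ge0// lee_fin.
pose a s := \int[u s \x u s]_p ((f p.2)%:E * total_rate K p.1 p.2).
pose b s := \int[u0 \x u s]_p ((f p.2)%:E * (phi p)%:E).
have a0 s : 0 <= a s by exact: integral_ge0.
have b0 s : 0 <= b s by exact: integral_ge0.
have ma : measurable_fun D a.
  by apply: measurable_funS DT _ => //; exact: measurable_time_product.
have mb : measurable_fun D b.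
  by apply: measurable_funS DT _ => //; exact: measurable_time_product_fixed.
have afin : \int[lebesgue_measure]_(s in D) a s < +oo.
  have := flory_fin_coag sol test_f t0; rewrite -/D; apply: le_lt_trans.
  rewrite le_eqVlt; apply/orP; left; apply/eqP; apply: eq_integral => s _.
  by apply: eq_integral => p _; rewrite gee0_abs.
have bfin : \int[lebesgue_measure]_(s in D) b s < +oo.
  have := flory_fin_phi sol test_f t0; rewrite -/D; apply: le_lt_trans.
  rewrite le_eqVlt; apply/orP; left; apply/eqP; apply: eq_integral => s _.
  by apply: eq_integral => p _; rewrite EFinM gee0_abs.
pose Z s := flory_gain K (u s) f - flory_loss K phi u0 (u s) f.
have mZ : measurable_fun D Z.
  apply: measurable_funS DT _ => //; apply: emeasurable_funB.
    apply: measurable_funeM; apply: measurable_time_product => //.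
      by move=> p; apply: integral_ge0 => z _; exact: F0.
    by apply: measurable_fun_integral_kernel => // U; exact: measurable_kernel.
  apply: emeasurable_funD; first exact: measurable_time_product.
  pose h (q : measurableTypeR R * E) := (f q.2)%:E * (integral_section u0 q.2 -
    \int[u (Order.max q.1 0%R)]_x (phi (x, q.2))%:E).
  apply: (@eq_measurable_fun _ _ _ _ _ (fun s => \int[u s]_y h (s, y))).
    move=> s; rewrite inE /= in_itv/= andbT => s0.
    by apply: eq_integral => y _; rewrite /h/= max_l.
  apply: measurable_time_integral => //.
    move=> s y s0; rewrite /h/= mule_ge0 ?lee_fin// max_l//.
    have := flory_conserved_le sol y s0.
    rewrite sube_ge0//; apply/orP; left.
    rewrite ge0_fin_numE; last by apply: integral_ge0 => x _; rewrite lee_fin.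
    exact: le_lt_trans (flory_conserved_le sol y s0) (Phi_fin y).
  apply: emeasurable_funM; first exact: (measurableT_comp mF).
  apply: emeasurable_funB; first exact: (measurableT_comp (measurable_section u0)).
  by apply: (measurable_time_section mu (f := EFin \o phi)) => //;
    exact/measurable_EFinP.
pose leb : {measure set (measurableTypeR R) -> \bar R} := @lebesgue_measure R.
have outfin :
    \int[leb]_(s in D) outflow K phi u0 (u s) (EFin \o f) < +oo.
  have -> : \int[leb]_(s in D) outflow K phi u0 (u s) (EFin \o f) =
      \int[leb]_(s in D) a s + \int[leb]_(s in D) b s.
    exact: (ge0_integralD leb mD (fun s _ => a0 s) ma (fun s _ => b0 s) mb).
  exact: lte_add_pinfty afin bfin.
have ae_fin (g : R -> \bar R) : measurable_fun D g -> (forall s, 0 <= g s) ->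
    \int[lebesgue_measure]_(s in D) g s < +oo ->
    {ae leb, forall s, D s -> g s \is a fin_num}.
  move=> mg g0 gfin; apply: integrable_ae => //; apply/integrableP; split => //.
  by under eq_integral do rewrite gee0_abs//.
(* Where a or b is infinite the two sides may differ; this is a null set. *)
have ZE : ae_eq leb D Z
    ((fun s => inflow K phi (u s) (EFin \o f)) \-
     (fun s => outflow K phi u0 (u s) (EFin \o f))).
  have := ae_fin _ ma a0 afin; have := ae_fin _ mb b0 bfin.
  apply: filterS2; first exact: (ae_filter_ringOfSetsType leb).
  move=> s bs as_ Ds; have {}as_ := as_ Ds; have {}bs := bs Ds.
  have [|E1 qs] := phi_loss_split (Dge0 _ Ds) mf f0.
    by rewrite -ge0_fin_numE; [exact: bs|exact: b0].
  rewrite /Z /flory_gain /flory_loss E1 /inflow /outflow -/(a s) -/(b s) /=.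
  apply: sube_rearrange => //; rewrite mule_ge0 ?lee_fin//.
  by apply: integral_ge0 => p _; apply: integral_ge0 => z _; exact: F0.
have Eq := flory_eq sol test_f t0; rewrite -/D in Eq.
have utfin := test_function_fin_num (u t) test_f f0.
have u0fin := test_function_fin_num u0 test_f f0.
have Zfin : \int[lebesgue_measure]_(s in D) Z s \is a fin_num.
  move: utfin u0fin; rewrite Eq.
  by case: (integral u0) => // r; case: integral.
have mX : measurable_fun D (fun s => inflow K phi (u s) (EFin \o f)).
  by apply: measurable_funS DT _ => //; exact: measurable_inflow.
have mY : measurable_fun D (fun s => outflow K phi u0 (u s) (EFin \o f)).
  by apply: measurable_funS DT _ => //; exact: measurable_outflow.
split.
  rewrite Eq -addeA; congr (_ + _); apply/esym.
  apply: (@integral_ae_difference _ _ _ leb D mD _ _ _ mX mY mZ) => //.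
    by move=> s _; exact: inflow_ge0.
  by move=> s _; exact: outflow_ge0.
by rewrite lte_add_pinfty// -ge0_fin_numE//; apply: integral_ge0 => x _; exact: F0.
Qed.

End balance_of_solution.

Section balance_of_sets.
Local Open Scope ereal_scope.
Context {R : realType} {d : measure_display} {E : metricMeasurableType R d}.
Hypothesis E_borel : borel_sigma_algebra E.
Hypothesis E_sigma_compact : sigma_compact E.
Hypothesis lcE : locally_compact [set: E].
Variables (K : R.-ker (E * E) ~> E) (phi : E * E -> R).
Hypothesis K_fin : forall x y, total_rate K x y < +oo.
Hypothesis mphi : measurable_fun setT phi.
Hypothesis phi_ge0 : forall p, (0 <= phi p)%R.
Variable u0 : {finite_measure set E -> \bar R}.
Hypothesis Phi_fin : forall y, \int[u0]_x (phi (x, y))%:E < +oo.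
Variable u : R -> {finite_measure set E -> \bar R}.
Hypothesis sol : flory_solution K phi u0 u.

Let mu := flory_measurable sol.

(** The equation for indicators, which are the functions that the localization
    to a domain requires. *)
Lemma balance_set (t : R) (A : set E) : (0 <= t)%R -> measurable A ->
  u t A + \int[lebesgue_measure]_(s in `[0%R, t])
    outflow K phi u0 (u s) (fun x => (\1_A x)%:E) =
  u0 A + \int[lebesgue_measure]_(s in `[0%R, t])
    inflow K phi (u s) (fun x => (\1_A x)%:E).
Proof.
move=> t0 mA; rewrite -(integral_indicT (u t) mA) -(integral_indicT u0 mA).
have rout := represented_outflow K_fin mphi phi_ge0 u0 mu t.
have rin := represented_inflow K mphi phi_ge0 u0 mu t.
have test f (test_f : compactly_supported_continuous f) f0 :=
  balance_test_function E_borel mphi phi_ge0 Phi_fin sol t0 test_f f0.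
exact: (represented_eq_indic E_borel E_sigma_compact lcE rout rin
  (fun f test_f f0 => (test f test_f f0).1)
  (fun f test_f f0 => (test f test_f f0).2) mA).
Qed.

Lemma balance_set_lt_pinfty (t : R) (C A : set E) : (0 <= t)%R -> compact C ->
  measurable A -> A `<=` C ->
  u t A + \int[lebesgue_measure]_(s in `[0%R, t])
    outflow K phi u0 (u s) (fun x => (\1_A x)%:E) < +oo.
Proof.
move=> t0 cC mA AC; rewrite -(integral_indicT (u t) mA).
have rout := represented_outflow K_fin mphi phi_ge0 u0 mu t.
apply: (le_lt_trans (represented_le_indic rout mA _ AC)).
  exact: compact_measurable_borel.
apply: (represented_indic_lt_pinfty E_borel lcE rout) => // f test_f f0.
by have [] := balance_test_function E_borel mphi phi_ge0 Phi_fin sol t0 test_f f0.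
Qed.

End balance_of_sets.

(** * Autonomy and Lipschitz estimate on a domain *)

Section domain.
Local Open Scope ereal_scope.
Context {R : realType} {d : measure_display} {E : metricMeasurableType R d}.
Variables (phi : E * E -> R) (u0 : {finite_measure set E -> \bar R}).
Hypothesis mphi : measurable_fun setT phi.
Hypothesis phi_ge0 : forall p, (0 <= phi p)%R.

Let Phi x := \int[u0]_y (phi (x, y))%:E.

Lemma measurable_flory_potential : measurable_fun setT Phi.
Proof.
apply: (measurable_fun_fubini_tonelli_F (EFin \o phi)).
  exact/measurable_EFinP.
by move=> p; rewrite lee_fin.
Qed.

Lemma measurable_flory_domain k : measurable (flory_domain phi u0 k).
Proof.
rewrite /flory_domain -[X in measurable X]setTI.
exact: (emeasurable_fun_infty_c measurableT measurable_flory_potential).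
Qed.

Lemma flory_domain_le k l : (k <= l)%R ->
  flory_domain phi u0 k `<=` flory_domain phi u0 l.
Proof. by move=> kl x /= /le_trans; apply; rewrite lee_fin. Qed.

Variables (K : R.-ker (E * E) ~> E).
Hypothesis K_fin : forall x y, total_rate K x y < +oo.
Hypothesis phi_conserved : conserved_quantity K phi.

(** The potential [Phi] is additive along coagulations, because [phi] is in its
    first variable. Since [Phi] is nonnegative, a particle in the domain of
    level [k] cannot have a parent outside of it: computing the integral of
    [Phi] over [A] in two ways gives
    [K (x, y) A * (Phi x + Phi y) <= K (x, y) A * k]. *)
Lemma coagulation_outside_domain (k : R) (A : set E) (x y : E) :
  (0 <= k)%R -> measurable A -> A `<=` flory_domain phi u0 k ->
  ~ (flory_domain phi u0 k x /\ flory_domain phi u0 k y) -> K (x, y) A = 0.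
Proof.
move=> k0 mA AD xyD.
have Kfin : fin_num_fun (K (x, y)).
  by apply: lty_fin_num_fun; exact: K_fin.
pose kxy : {finite_measure set E -> \bar R} := finite_copy Kfin.
have Phi_ge0 z : 0 <= Phi z by apply: integral_ge0 => q _; rewrite lee_fin.
have mPhi := measurable_flory_potential.
have m1A : measurable_fun setT (fun z => (\1_A z)%:E : \bar R).
  exact: measurable_EFin_indic.
have ind_ge0 z : 0 <= (\1_A z)%:E :> \bar R by rewrite lee_fin.
have kA : \int[kxy]_z (\1_A z)%:E = K (x, y) A by rewrite integral_indicT.
have mphix z : measurable_fun setT (fun q => (phi (z, q))%:E).
  by apply/measurable_EFinP; exact: measurableT_comp mphi _.
have mphiq q : measurable_fun setT (fun z => (phi (z, q))%:E).
  by apply/measurable_EFinP; exact: measurableT_comp mphi _.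
have mphi1 : measurable_fun setT
    (fun p : E * E => (\1_A p.1)%:E * (phi p)%:E).
  apply: emeasurable_funM; last exact/measurable_EFinP.
  exact: (measurableT_comp m1A).
have upper : \int[kxy]_z ((\1_A z)%:E * Phi z) <= K (x, y) A * k%:E.
  rewrite -kA muleC -ge0_integralZl ?lee_fin//; apply: ge0_le_integral => //.
  - by move=> z _; rewrite mule_ge0.
  - exact: emeasurable_funM.
  - exact: measurable_funeM.
  - move=> z _; have [zA|zA] := pselect (A z).
      by rewrite indicE mem_set// mul1e mule1; exact: AD.
    by rewrite indicE memNset// mul0e mule0.
have lower : \int[kxy]_z ((\1_A z)%:E * Phi z) = K (x, y) A * (Phi x + Phi y).
  transitivity (\int[kxy]_z \int[u0]_q ((\1_A z)%:E * (phi (z, q))%:E)).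
    apply: eq_integral => z _; rewrite ge0_integralZl//.
    by move=> q _; rewrite lee_fin.
  rewrite (fubini_tonelli (fun p : E * E => (\1_A p.1)%:E * (phi p)%:E))//=; last first.
    by move=> p; rewrite mule_ge0 ?lee_fin.
  transitivity (\int[u0]_q (K (x, y) A * ((phi (x, q))%:E + (phi (y, q))%:E))).
    apply: eq_integral => q _.
    transitivity (\int[kxy]_z ((\1_A z)%:E * (phi (x, q) + phi (y, q))%:E)).
      apply: ae_eq_integral => //.
      - exact: emeasurable_funM.
      - exact: emeasurable_funM.
      - by have := phi_conserved x y q; apply: filterS => z -> _.
    rewrite ge0_integralZr ?lee_fin ?addr_ge0// kA.
    by rewrite EFinD.
  rewrite ge0_integralZl//; last 2 first.
  - exact: emeasurable_funD.
  - by move=> q _; rewrite adde_ge0 ?lee_fin.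
  by rewrite ge0_integralD// => q _; rewrite lee_fin.
have : K (x, y) A \is a fin_num by have := Kfin; apply.
have : 0 <= K (x, y) A by exact: measure_ge0.
move: upper; rewrite lower; case: (K (x, y) A) => [r| |]//.
rewrite lee_fin => + r0 _; move: r0; rewrite le_eqVlt => /predU1P[<-//|r0].
rewrite lee_pmul2l// => Phixy; exfalso; apply: xyD; split; rewrite /flory_domain/=.
  by apply: le_trans Phixy; rewrite leeDl.
by apply: le_trans Phixy; rewrite leeDr.
Qed.

End domain.

Section flow_comparison.
Local Open Scope ereal_scope.
Context {R : realType} {d : measure_display} {E : metricMeasurableType R d}.
Variables (K : R.-ker (E * E) ~> E) (phi : E * E -> R).
Variable u0 : {finite_measure set E -> \bar R}.
Hypothesis mphi : measurable_fun setT phi.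
Hypothesis phi_ge0 : forall p, (0 <= phi p)%R.
Hypothesis phi_sym : forall x y, phi (x, y) = phi (y, x).
Hypothesis phi_conserved : conserved_quantity K phi.
Variable c : R.
Hypothesis c0 : (0 < c)%R.
Hypothesis K_le_phi : forall x y, total_rate K x y <= (c * phi (x, y))%:E.
Variable k : R.
Hypothesis k0 : (0 <= k)%R.
Let D := flory_domain phi u0 k.
Hypothesis phi_eq_K : forall x y, ~ (D x /\ D y) ->
  (phi (x, y))%:E = total_rate K x y.

(** The inequality that a solution satisfies at each time. The estimates below
    concern two fixed measures and use nothing else of the solutions. *)
Definition dominated_flux (m : {finite_measure set E -> \bar R}) :=
  forall y, \int[m]_x (phi (x, y))%:E <= \int[u0]_x (phi (x, y))%:E.

Let K_fin x y : total_rate K x y < +oo.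
Proof. by rewrite (le_lt_trans (K_le_phi x y))// ltry. Qed.

Let mphil y : measurable_fun setT (fun x => (phi (x, y))%:E).
Proof. by apply/measurable_EFinP; exact: measurableT_comp mphi _. Qed.

Let flux_le (m : {finite_measure set E -> \bar R}) y :
  dominated_flux m -> D y -> \int[m]_x (phi (x, y))%:E <= k%:E.
Proof.
move=> dm Dy; apply: (le_trans (dm y)); move: Dy; rewrite /D /flory_domain/=.
by under eq_integral do rewrite phi_sym.
Qed.

(* Although phi is not assumed bounded on D, its integrals against the solution
   are bounded by k there. *)
Let marginal_le (m : {finite_measure set E -> \bar R}) (C : R)
    (F : E -> \bar R) y : dominated_flux m -> (0 <= C)%R ->
  measurable_fun setT F -> (forall x, 0 <= F x) ->
  (forall x, F x <= (C * phi (x, y))%:E) -> (~ D y -> forall x, F x = 0) ->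
  \int[m]_x F x <= (C * k)%:E.
Proof.
move=> dm C0 mF F0 FC FD; have [Dy|/FD Fy] := pselect (D y); last first.
  by rewrite integral0_eq// lee_fin mulr_ge0.
apply: (@le_trans _ _ (\int[m]_x (C%:E * (phi (x, y))%:E))).
  apply: ge0_le_integral => //; exact: measurable_funeM.
rewrite ge0_integralZl ?lee_fin// => [|x _]; last by rewrite lee_fin.
by rewrite EFinM lee_wpmul2l ?lee_fin// flux_le.
Qed.

Let product_compare (m n : {finite_measure set E -> \bar R}) (b C : R)
    (F : E * E -> \bar R) :
  dominated_flux m -> dominated_flux n -> (0 <= b)%R -> (0 <= C)%R ->
  (forall B, measurable B -> B `<=` D -> m B <= n B + b%:E) ->
  measurable_fun setT F -> (forall p, 0 <= F p) ->
  (forall x y, F (x, y) <= (C * phi (x, y))%:E) ->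
  (forall x y, ~ (D x /\ D y) -> F (x, y) = 0) ->
  \int[m \x m]_p F p <= \int[n \x n]_p F p + (2 * (C * k * b))%:E.
Proof.
move=> dm dn b0 C0 mn mF F0 FC FD.
apply: (le_integral_product_of_le_measure mn) => //; last exact: mulr_ge0.
- move=> x; apply: (marginal_le (y := x)) => //.
  + exact: measurableT_comp mF _.
  + by move=> y; rewrite phi_sym.
  + by move=> Dx y; apply: FD => -[].
- move=> y; apply: (marginal_le (y := y)) => //.
  + exact: measurableT_comp mF _.
  + by move=> Dy x; apply: FD => -[].
Qed.

Let adde_regroup (a f h p a' f' h' p' s t c1 c2 c3 c4 : \bar R) :
  a + f + (h + p) <= a' + c1 + (f' + c2) + (h' + c3 + (p' + c4)) ->
  a + (f + s) + (h + t + p) <=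
  a' + (f' + t) + (h' + s + p') + (c1 + c2 + (c3 + c4)).
Proof.
move=> le_.
rewrite [leLHS](AC (1*2*(2*1)) ((1*2)*(4*6)*(3*5)))/=.
rewrite [leRHS](AC (1*2*(2*1)*(2*2)) (((1*7)*(2*8)*((4*9)*(6*10)))*(5*3)))/=.
by rewrite leeD2r.
Qed.

(** The Lipschitz estimate. Each term is compared separately; the constants are
    [c k b] for the gain (halved), [2 k b] for the phi-correction, [2 c k b] for
    the collisions and [k b] for the influence of [u0]. The collision and
    phi-correction terms involve partners of all types, not only those in [D],
    and for these the two measures cannot be compared; but there [phi] equals
    the total rate, so that the same quantity appears on both sides. *)
Lemma flow_compare (m n : {finite_measure set E -> \bar R}) (b : R)
    (A : set E) : (0 <= b)%R -> dominated_flux m -> dominated_flux n ->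
  (forall B, measurable B -> B `<=` D -> m B <= n B + b%:E) ->
  (forall B, measurable B -> B `<=` D -> n B <= m B + b%:E) ->
  measurable A -> A `<=` D ->
  inflow K phi m (fun x => (\1_A x)%:E) +
    outflow K phi u0 n (fun x => (\1_A x)%:E) <=
  inflow K phi n (fun x => (\1_A x)%:E) +
    outflow K phi u0 m (fun x => (\1_A x)%:E) +
  (k * (3 * c + 3) * b)%:E.
Proof.
move=> b0 dm dn mn nm mA AD.
have mD : measurable D by exact: measurable_flory_domain.
pose ind (B : set E) x : \bar R := (\1_B x)%:E.
have ind0 B x : 0 <= ind B x by rewrite lee_fin.
have mind B : measurable B -> measurable_fun setT (ind B).
  by move=> mB; exact: measurable_EFin_indic.
have mT1 (g : E -> \bar R) : measurable_fun setT g ->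
  measurable_fun setT (fun p : E * E => g p.1).
  by move=> mg; exact: (measurableT_comp mg).
have mT2 (g : E -> \bar R) : measurable_fun setT g ->
  measurable_fun setT (fun p : E * E => g p.2).
  by move=> mg; exact: (measurableT_comp mg).
(* G is the common contribution of the partners outside D. *)
pose G p := ind A p.2 * ind (~` D) p.1 * (phi p)%:E.
pose F1 p := ind A p.2 * ind D p.1 * (phi p)%:E.
pose F2 p := ind A p.2 * ind D p.1 * total_rate K p.1 p.2.
have G0 p : 0 <= G p by rewrite !mule_ge0// lee_fin.
have F10 p : 0 <= F1 p by rewrite !mule_ge0// lee_fin.
have F20 p : 0 <= F2 p by rewrite !mule_ge0.
have mG : measurable_fun setT G.
  apply: emeasurable_funM; last exact/measurable_EFinP.
  apply: emeasurable_funM; first exact: (mT2 _ (mind _ mA)).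
  exact: (mT1 _ (mind _ (measurableC mD))).
have mF1 : measurable_fun setT F1.
  apply: emeasurable_funM; last exact/measurable_EFinP.
  by apply: emeasurable_funM; [exact: (mT2 _ (mind _ mA))|exact: (mT1 _ (mind _ mD))].
have mF2 : measurable_fun setT F2.
  apply: emeasurable_funM; last exact: measurable_total_rate.
  by apply: emeasurable_funM; [exact: (mT2 _ (mind _ mA))|exact: (mT1 _ (mind _ mD))].
have phiE (v : {finite_measure set E -> \bar R}) :
    \int[v \x v]_p ((\1_A p.2)%:E * (phi p)%:E) =
    \int[v \x v]_p F1 p + \int[v \x v]_p G p.
  rewrite -ge0_integralD//; apply: eq_integral => -[x y] _.
  rewrite /F1 /G /ind/= !indicE in_setC.
  by case: (x \in D); rewrite /= ?mule1 ?mule0 ?mul0e ?adde0 ?add0e.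
have rateE (v : {finite_measure set E -> \bar R}) :
    \int[v \x v]_p ((\1_A p.2)%:E * total_rate K p.1 p.2) =
    \int[v \x v]_p F2 p + \int[v \x v]_p G p.
  rewrite -ge0_integralD//; apply: eq_integral => -[x y] _.
  rewrite /F2 /G /ind/= !indicE in_setC.
  have [Dx|Dx] := boolP (x \in D); rewrite /= ?mule1 ?mule0 ?mul0e ?adde0 ?add0e//.
  by rewrite phi_eq_K// => -[]; rewrite notin_setE in Dx.
have FD x y : ~ (D x /\ D y) -> ind A y * ind D x = 0.
  move=> xyD; rewrite /ind !indicE.
  have [Ay|Ay] := pselect (A y); last by rewrite (memNset Ay) mul0e.
  by rewrite (@memNset _ D x) ?mule0// => Dx; apply: xyD; split => //; exact: AD.
have ind_le B x : ind B x <= 1.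
  by rewrite /ind indicE lee_fin; case: (_ \in _).
have F_le x y (w : \bar R) : 0 <= w -> ind A y * ind D x * w <= w.
  by move=> w0; rewrite -[leRHS]mul1e lee_wpmul2r// -[leRHS]mule1 lee_pmul.
have C1 : \int[m \x m]_p K p A <= \int[n \x n]_p K p A + (2 * (c * k * b))%:E.
  apply: (@product_compare m n b c) => //.
  - exact: ltW.
  - exact: measurable_kernel.
  - move=> x y; apply: le_trans (K_le_phi x y).
    by apply: le_measure => //; rewrite inE.
  - move=> x y xyD.
    exact: (coagulation_outside_domain mphi phi_ge0 K_fin phi_conserved k0 mA AD).
have C2 : \int[m \x m]_p F1 p <= \int[n \x n]_p F1 p + (2 * (1 * k * b))%:E.
  apply: (@product_compare m n b 1) => //.
  - by move=> x y; rewrite mul1r; apply: F_le; rewrite lee_fin.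
  - by move=> x y xyD; rewrite /F1/= FD// mul0e.
have C3 : \int[n \x n]_p F2 p <= \int[m \x m]_p F2 p + (2 * (c * k * b))%:E.
  apply: (@product_compare n m b c) => //.
  - exact: ltW.
  - by move=> x y; apply: le_trans (K_le_phi x y); exact: F_le.
  - by move=> x y xyD; rewrite /F2/= FD// mul0e.
have pairE (v : {finite_measure set E -> \bar R}) :
    \int[u0 \x v]_p ((\1_A p.2)%:E * (phi p)%:E) =
    \int[v]_y (ind A y * \int[u0]_x (phi (x, y))%:E).
  rewrite fubini_tonelli2//.
  - apply: eq_integral => y _; rewrite /fubini_G/= ge0_integralZl//.
    by move=> x _; rewrite lee_fin.
  - apply: emeasurable_funM; last exact/measurable_EFinP.
    exact: (mT2 _ (mind _ mA)).
  - by move=> p; rewrite mule_ge0 ?lee_fin.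
have C4 : \int[u0 \x n]_p ((\1_A p.2)%:E * (phi p)%:E) <=
    \int[u0 \x m]_p ((\1_A p.2)%:E * (phi p)%:E) + (k * b)%:E.
  rewrite !pairE; apply: (le_integral_of_le_measure nm) => //.
  - apply: emeasurable_funM; first exact: mind.
    apply: (measurable_fun_fubini_tonelli_G (EFin \o phi)).
      exact/measurable_EFinP.
    by move=> p; rewrite lee_fin.
  - move=> y; rewrite mule_ge0//.
    by apply: integral_ge0 => x _; rewrite lee_fin.
  - move=> y; have [Ay|Ay] := pselect (A y).
      by rewrite /ind indicE mem_set// mul1e flux_le//; exact: AD.
    by rewrite /ind indicE memNset// mul0e lee_fin.
  - move=> y Dy; rewrite /ind indicE memNset ?mul0e// => Ay.
    by apply: Dy; exact: AD.
have gainE (v : {finite_measure set E -> \bar R}) :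
    \int[v \x v]_p \int[K p]_z (\1_A z)%:E = \int[v \x v]_p K p A.
  by apply: eq_integral => p _; rewrite integral_indicT.
rewrite /inflow /outflow !gainE !phiE !rateE.
have {}C1 : (2^-1)%:E * \int[m \x m]_p K p A <=
    (2^-1)%:E * \int[n \x n]_p K p A + (c * k * b)%:E.
  rewrite (_ : (c * k * b)%:E = (2^-1)%:E * (2 * (c * k * b))%:E); last first.
    by rewrite -EFinM mulKf.
  by rewrite -ge0_muleDr ?lee_fin ?mulr_ge0 ?integral_ge0 ?(ltW c0)// lee_wpmul2l.
have -> : (k * (3 * c + 3) * b)%:E = (c * k * b)%:E + (2 * (1 * k * b))%:E +
    ((2 * (c * k * b))%:E + (k * b)%:E).
  by rewrite -!EFinD; congr EFin; ring.
have := leeD (leeD C1 C2) (leeD C3 C4).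
exact: adde_regroup.
Qed.

End flow_comparison.

(** * Uniqueness *)

Section gronwall.
Local Open Scope ereal_scope.
Context {R : realType} {d : measure_display} {E : metricMeasurableType R d}.
Hypothesis E_borel : borel_sigma_algebra E.
Hypothesis E_sigma_compact : sigma_compact E.
Hypothesis lcE : locally_compact [set: E].
Variables (K : R.-ker (E * E) ~> E) (phi : E * E -> R).
Variable u0 : {finite_measure set E -> \bar R}.
Hypothesis mphi : measurable_fun setT phi.
Hypothesis phi_ge0 : forall p, (0 <= phi p)%R.
Hypothesis phi_sym : forall x y, phi (x, y) = phi (y, x).
Hypothesis phi_conserved : conserved_quantity K phi.
Variable c : R.
Hypothesis c0 : (0 < c)%R.
Hypothesis K_le_phi : forall x y, total_rate K x y <= (c * phi (x, y))%:E.
Hypothesis Phi_fin : forall y, \int[u0]_x (phi (x, y))%:E < +oo.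
Variable k : R.
Hypothesis k0 : (0 <= k)%R.
Let D := flory_domain phi u0 k.
Hypothesis compactD : compact D.
Hypothesis phi_eq_K : forall x y, ~ (D x /\ D y) ->
  (phi (x, y))%:E = total_rate K x y.

Let K_fin x y : total_rate K x y < +oo.
Proof. by rewrite (le_lt_trans (K_le_phi x y))// ltry. Qed.

Let C := (k * (3 * c + 3))%R.

Let C0 : (0 <= C)%R.
Proof. by rewrite mulr_ge0// addr_ge0// mulr_ge0// ltW. Qed.

Let mD : measurable D.
Proof. exact: measurable_flory_domain. Qed.

(** The Lipschitz estimate integrated in time. Both inequalities at earlier times
    are needed for one at time [t], since gain and loss have opposite signs. *)
Lemma gronwall_step (u v : R -> {finite_measure set E -> \bar R})
    (b : R -> R) (t : R) :
  flory_solution K phi u0 u -> flory_solution K phi u0 v -> (0 <= t)%R ->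
  measurable_fun (`[0%R, t] : set R) b -> (forall s, (0 <= s)%R -> (0 <= b s)%R) ->
  (forall s, (0 <= s <= t)%R -> forall B, measurable B -> B `<=` D ->
    u s B <= v s B + (b s)%:E /\ v s B <= u s B + (b s)%:E) ->
  forall A, measurable A -> A `<=` D ->
  u t A <= v t A + \int[lebesgue_measure]_(s in `[0%R, t]) (C * b s)%:E.
Proof.
move=> su sv t0 mb b0 uv A mA AD.
pose T : set R := `[0%R, t]%classic.
have mT : measurable T by exact: measurable_itv.
have DT : T `<=` `[0%R, +oo[%classic.
  by move=> s; rewrite /T/= !in_itv/= andbT => /andP[].
pose F (x : E) : \bar R := (\1_A x)%:E.
have F0 x : 0 <= F x by rewrite lee_fin.
have mF : measurable_fun setT F by exact: measurable_EFin_indic.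
pose leb : {measure set (measurableTypeR R) -> \bar R} := @lebesgue_measure R.
have fin_o w : flory_solution K phi u0 w ->
    \int[leb]_(s in T) outflow K phi u0 (w s) F \is a fin_num.
  move=> sw; rewrite ge0_fin_numE; last first.
    by apply: integral_ge0 => s _; exact: outflow_ge0.
  apply: le_lt_trans (balance_set_lt_pinfty E_borel lcE K_fin mphi phi_ge0
    Phi_fin sw t0 compactD mA AD).
  by rewrite leeDr.
have mo w : flory_solution K phi u0 w ->
    measurable_fun T (fun s => outflow K phi u0 (w s) F).
  move=> sw; apply: (measurable_funS _ DT) => //.
  exact: (measurable_outflow K mphi phi_ge0 u0 (flory_measurable sw) F0 mF).
have mi w : flory_solution K phi u0 w ->
    measurable_fun T (fun s => inflow K phi (w s) F).
  move=> sw; apply: (measurable_funS _ DT) => //.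
  exact: (measurable_inflow K mphi phi_ge0 (flory_measurable sw) F0 mF).
have mCb : measurable_fun T (fun s => (C * b s)%:E).
  by apply/measurable_EFinP; exact: measurable_funM.
have Cb0 s : T s -> 0 <= (C * b s)%:E.
  by rewrite /T/= in_itv/= lee_fin => /andP[s0 _]; rewrite mulr_ge0// b0.
have balance w : flory_solution K phi u0 w ->
    w t A + \int[leb]_(s in T) outflow K phi u0 (w s) F =
    u0 A + \int[leb]_(s in T) inflow K phi (w s) F.
  move=> sw; exact: (balance_set E_borel E_sigma_compact lcE K_fin mphi phi_ge0
    Phi_fin sw t0 mA).
apply: (@integral_balance_gap _ _ R leb T mT _ _ _ _ _ _ _ _ (mi u su) (mo u su)
  (mi v sv) (mo v sv) mCb _ _ _ _ Cb0 _ (balance u su) (balance v sv)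
  (fin_o u su) (fin_o v sv)).
- by move=> s _; exact: inflow_ge0.
- by move=> s _; exact: outflow_ge0.
- by move=> s _; exact: inflow_ge0.
- by move=> s _; exact: outflow_ge0.
move=> s Ts; have s0t : (0 <= s <= t)%R by move: Ts; rewrite /T/= in_itv.
have /andP[s0 _] := s0t.
apply: (flow_compare mphi phi_ge0 phi_sym phi_conserved c0 K_le_phi k0 phi_eq_K
  (b0 _ s0)) => //.
- by move=> y; exact: (flory_conserved_le su).
- by move=> y; exact: (flory_conserved_le sv).
- by move=> B mB BD; have [] := uv s s0t B mB BD.
- by move=> B mB BD; have [] := uv s s0t B mB BD.
Qed.

(** Iterating [gronwall_step] from the constant bound given by the total masses
    of [D]; these are bounded in time because the inflow is nonnegative. *)
Lemma gronwall_bound (u v : R -> {finite_measure set E -> \bar R}) (t : R) :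
  flory_solution K phi u0 u -> flory_solution K phi u0 v -> (0 <= t)%R ->
  exists2 b : R, (0 <= b)%R & forall n s, (0 <= s <= t)%R ->
    forall A, measurable A -> A `<=` D ->
    u s A <= v s A + (b * exp_coeff (C * s) n)%:E /\
    v s A <= u s A + (b * exp_coeff (C * s) n)%:E.
Proof.
move=> su sv t0.
have bound w : flory_solution K phi u0 w -> exists2 b : R, (0 <= b)%R &
    forall s, (0 <= s <= t)%R -> forall A, measurable A -> A `<=` D ->
    w s A <= b%:E.
  move=> sw.
  pose F (x : E) : \bar R := (\1_D x)%:E.
  have F0 x : 0 <= F x by rewrite lee_fin.
  have mF : measurable_fun setT F by exact: measurable_EFin_indic.
  pose M s := u0 D + \int[lebesgue_measure]_(r in `[0%R, s]) inflow K phi (w r) F.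
  have ME s : (0 <= s)%R -> w s D <= M s.
    move=> s0; rewrite /M.
    rewrite -(balance_set E_borel E_sigma_compact lcE K_fin mphi phi_ge0 Phi_fin sw s0 mD).
    by rewrite leeDl//; apply: integral_ge0 => r _; exact: outflow_ge0.
  have Mfin : M t \is a fin_num.
    rewrite ge0_fin_numE; last first.
      by rewrite adde_ge0//; apply: integral_ge0 => r _; exact: inflow_ge0.
    rewrite /M -(balance_set E_borel E_sigma_compact lcE K_fin mphi phi_ge0 Phi_fin sw t0 mD).
    exact: (balance_set_lt_pinfty E_borel lcE K_fin mphi phi_ge0 Phi_fin sw t0 compactD mD).
  exists (fine (M t)).
    by rewrite fine_ge0// adde_ge0//; apply: integral_ge0 => r _; exact: inflow_ge0.
  move=> s /andP[s0 st] A mA AD; rewrite fineK//.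
  apply: (@le_trans _ _ (w s D)); first by rewrite le_measure// inE.
  apply: (le_trans (ME s s0)); rewrite leeD2l//.
  apply: ge0_subset_integral => //.
  - apply: measurable_funS (measurable_inflow K mphi phi_ge0 (flory_measurable sw) F0 mF) => //.
    by move=> r; rewrite /= !in_itv/= andbT => /andP[].
  - by move=> r _; exact: inflow_ge0.
  - by move=> r; rewrite /= !in_itv/= => /andP[-> /le_trans ->].
have [bu bu0 bound_u] := bound u su; have [bv bv0 bound_v] := bound v sv.
pose b := (bu + bv)%R; have b0 : (0 <= b)%R by exact: addr_ge0.
exists b => //.
elim=> [|n IHn] s s0t A mA AD.
  rewrite /b /exp_coeff/= expr0 divr1 mulr1; split.
    apply: (le_trans (bound_u s s0t A mA AD)).
    by rewrite EFinD addeCA leeDl// adde_ge0// lee_fin.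
  apply: (le_trans (bound_v s s0t A mA AD)).
  by rewrite EFinD addeA leeDr// adde_ge0// lee_fin.
have /andP[s0 st] := s0t.
rewrite -integral_exp_coeff//.
have mb : measurable_fun (`[0%R, s] : set R)
    (fun r => (b * exp_coeff (C * r) n)%R).
  rewrite /exp_coeff/=; apply: measurable_funM => //; apply: measurable_funM => //.
  by apply: measurable_funX; exact: measurable_funM.
have b_ge0 r : (0 <= r)%R -> (0 <= b * exp_coeff (C * r) n)%R.
  by move=> r0; rewrite mulr_ge0// exp_coeff_ge0// mulr_ge0.
split; apply: (gronwall_step (b := fun r => (b * exp_coeff (C * r) n)%R)) => //.
- by move=> r /andP[r0 rs] B mB BD; apply: IHn => //; rewrite r0 (le_trans rs).
- move=> r /andP[r0 rs] B mB BD; apply/and_comm; apply: IHn => //.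
  by rewrite r0 (le_trans rs).
Qed.

Lemma flory_solution_unique_on_domain
    (u v : R -> {finite_measure set E -> \bar R}) (t : R) (A : set E) :
  flory_solution K phi u0 u -> flory_solution K phi u0 v -> (0 <= t)%R ->
  measurable A -> A `<=` D -> u t A = v t A.
Proof.
move=> su sv t0 mA AD; have [b b0 uv] := gronwall_bound su sv t0.
have le_lim (x y : \bar R) :
    (forall n, x <= y + (b * exp_coeff (C * t) n)%:E) -> x <= y.
  move=> xy; apply/lee_addgt0Pr => e e0.
  have /cvgrPdist_le/(_ _ e0)[n _ /(_ n (leqnn n))] :
      (b * exp_coeff (C * t) n)%R @[n --> \oo] --> 0%R.
    by rewrite -[X in _ --> X](mulr0 b); apply: cvgMr; exact: cvg_exp_coeff.
  rewrite /= sub0r normrN => ne; apply: le_trans (xy n) _.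
  by rewrite leeD2l// lee_fin (le_trans (ler_norm _)).
have tt : (0 <= t <= t)%R by rewrite t0 lexx.
apply/eqP; rewrite eq_le; apply/andP; split; apply: le_lim => n.
  by have [] := uv n t tt A mA AD.
by have [] := uv n t tt A mA AD.
Qed.

End gronwall.

Theorem theorem2p4 (R : realType) (d : measure_display)
    (E : metricMeasurableType R d)
    (E_borel : borel_sigma_algebra E)
    (E_sigma_compact : sigma_compact E)
    (E_locally_compact : locally_compact [set: E])
    (m : E -> R) (m_measurable : measurable_fun setT m)
    (m_gt0 : forall x, 0 < m x)
    (K : R.-ker (E * E) ~> E) (K_coag : coagulation_kernel m K)
    (phi : E * E -> R) (phi_measurable : measurable_fun setT phi)
    (phi_conserved : conserved_quantity K phi)
    (phi_sym : forall x y, phi (x, y) = phi (y, x))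
    (mu0 : {finite_measure set E -> \bar R})
    (mu : R -> {finite_measure set E -> \bar R})
    (mu_solution : flory_solution K phi mu0 mu)
    (domain_compact : \forall k \near \oo, compact (flory_domain phi mu0 k%:R))
    (domain_cover : \bigcup_k flory_domain phi mu0 k%:R = setT)
    (K_le_phi : exists2 c : R, 0 < c &
      forall x y, (total_rate K x y <= (c * phi (x, y))%:E)%E)
    (phi_eq_K : exists2 r : R, 0 < r & forall x y,
      ~ (flory_domain phi mu0 r x /\ flory_domain phi mu0 r y) ->
      (phi (x, y))%:E = total_rate K x y) :
  forall nu : R -> {finite_measure set E -> \bar R},
    flory_solution K phi mu0 nu ->
    forall t, 0 <= t ->
    forall A : set E, measurable A -> nu t A = mu t A.
Proof.
have [c c0 K_le] := K_le_phi; have [r r0 phiK] := phi_eq_K.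
have phi_ge0 p : 0 <= phi p.
  case: p => x y; rewrite -(pmulr_rge0 _ c0) -lee_fin.
  by apply: le_trans (K_le x y); exact: measure_ge0.
have Phi_fin y : (\int[mu0]_x (phi (x, y))%:E < +oo)%E.
  have [k _ Dy] : (\bigcup_k flory_domain phi mu0 k%:R) y.
    by rewrite domain_cover.
  apply: le_lt_trans (ltry k%:R); move: Dy; rewrite /flory_domain/=.
  by under eq_integral do rewrite phi_sym.
move=> nu nu_solution t t0.
have ndD : nondecreasing_seq (fun k : nat => flory_domain phi mu0 k%:R).
  by move=> i j ij; apply/subsetPset/flory_domain_le; rewrite ler_nat.
apply: (eq_measure_near_cover _ ndD domain_cover).
  by move=> k; exact: (measurable_flory_domain mu0 phi_measurable phi_ge0).
near=> k => A mA AD.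
apply: (flory_solution_unique_on_domain E_borel E_sigma_compact
  E_locally_compact phi_measurable phi_ge0 phi_sym phi_conserved c0 K_le Phi_fin
  (ler0n R k) _ _ nu_solution mu_solution t0 mA AD).
  by near: k.
move=> x y xyD; apply: phiK => -[Dx Dy]; apply: xyD.
have rk : r <= k%:R by near: k; exact: nbhs_infty_ger.
by split; [exact: flory_domain_le rk _ Dx|exact: flory_domain_le rk _ Dy].
Unshelve. all: by end_near. Qed.
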